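(* Let $M$ be a smooth manifold with a Riemannian metric $G$ and a regular (constant-rank), non-integrable distribution $Q$. A solution $c:[a,b]\to M$ (with $\dot c(t)\neq0$ for all $t$) of the free nonholonomic mechanical system determined by the triple $(M,Q,G)$ is a solution of the corresponding vakonomic problem, and vice versa, if and only if there exists a section $\eta$ of $Q^0$ along $c$ such that $$\widetilde\nabla^B_{\dot c}\eta(t)=-\flat_G\big(\Pi^G(\dot c(t),\dot c(t))\big)$$ and such that, in addition, $\eta(t)\in\big(Q_{c(t)}+[\dot c(t),Q_{c(t)}]\big)^0$ for all $t$.
   Context: All manifolds are real, Hausdorff, second countable and $C^\infty$; $\mathcal F(M)$ denotes the smooth functions on $M$. A curve is a smooth map from a closed interval admitting a smooth extension to an open interval; it is tangent to $Q$ if $\dot c(t)\in Q_{c(t)}$ for all $t$. $Q^0\subset T^*M$ is the annihilator of $Q$, $Q^\bot$ the $G$-orthogonal complement, $\pi,\pi^\bot$ the orthogonal projections of $TM$ onto $Q,Q^\bot$; $\tau^\bot$ is the projection of $T^*M=(Q^\bot)^0\oplus Q^0$ onto $Q^0$; $\flat_G:TM\to T^*M$, $X\mapsto G(X,\cdot)$, with inverse $\sharp_G$; $\nabla^G$ is the Levi-Civita connection of $G$. $h_G$ is the restriction of $G$ to $Q$, $(M,Q,h_G)$ the associated sub-Riemannian structure, $g=\pi\circ\sharp_G:T^*M\to TM$ its associated bundle map (image $Q$, kernel $Q^0$), and $\overline g(\alpha,\beta)=\langle g(\alpha),\beta\rangle$. For $X,Y\in\Gamma(Q)$, $\eta\in\Gamma(Q^0)$: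 $\Pi^G(X,Y)=\pi^\bot(\nabla^G_XY)$ (tensorial, so defined pointwise); $\delta^B_X\eta=i_Xd\eta$; $\widetilde\nabla^B_X\eta=\tau^\bot(\delta^B_X\eta)$, which is $\mathcal F(M)$-linear in $X$ and satisfies $\widetilde\nabla^B_X(f\eta)=X(f)\eta+f\widetilde\nabla^B_X\eta$, hence induces a covariant derivative $\widetilde\nabla^B_{\dot c}$ of sections of $Q^0$ along curves $c$ tangent to $Q$. For $0\neq X_x\in Q_x$, $Q_x+[X_x,Q_x]=\mathrm{Span}\{Y(x)+[\tilde X,Y'](x)\mid Y,Y',\tilde X\in\Gamma(Q),\ \tilde X(x)=X_x\}\subset T_xM$; $(\cdot)^0$ denotes the annihilator. Solutions of the free nonholonomic mechanical system $(M,Q,G)$ are curves $c$ tangent to $Q$ with $\pi(\nabla^G_{\dot c}\dot c(t))=0$ for all $t$. Solutions of the corresponding vakonomic problem are the normal extremals of $(M,Q,h_G)$: curves $c$ tangent to $Q$ for which there is an integral curve $\psi$ of the Hamiltonian vector field on $T^*M$ of $H(\alpha_x)=\frac12\overline g(x)(\alpha_x,\alpha_x)$, not meeting the zero section of $T^*M$, that projects onto $c$.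
   Formalization: In the ''vice versa'' part, for a vakonomic solution c, the section η is required to be τ^⊥(ψ) for a normal lift ψ of c; with arbitrary η the claim fails (Heisenberg group: η = 0 works for every tangent curve, yet sub-Riemannian helices are not nonholonomic solutions). *)

(* Defs.v *)
From HB Require Import structures.
From mathcomp Require Import all_boot all_order all_algebra.
From mathcomp Require Import all_classical all_reals all_analysis.
Set Implicit Arguments.
Unset Strict Implicit.
Unset Printing Implicit Defensive.
Import Order.TTheory GRing.Theory Num.Theory.
Import numFieldNormedType.Exports.
Local Open Scope classical_set_scope.
Local Open Scope ring_scope.

(* [f] is C^k on [A] (meant for open [A]): all its iterated directional
   derivatives up to order [k] exist and are continuous on [A]. *)
Fixpoint Ck_on (R : realType) (V W : normedModType R) (k : nat)
    (A : set V) (f : V -> W) : Prop :=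
  if k is k'.+1 then
    forall v, (forall x, A x -> derivable f x v)
              /\ Ck_on k' A (fun x => 'D_v f x)
  else forall x, A x -> {for x, continuous f}.

Definition smooth_on (R : realType) (V W : normedModType R)
    (A : set V) (f : V -> W) : Prop := forall k, Ck_on k A f.

(* A smooth [n]-manifold, given by a smooth atlas. The chart [phi i] is only
   meaningful on [dom i], its inverse [psi i] only on [phi i @` dom i].
   As every point has a chart, a choice [chart_at] of one chart around each
   point is made part of the data (see [tcoord] for its use). *)
Record manifold (R : realType) (n : nat) := Manifold {
  carrier :> topologicalType;
  carrier_hausdorff : hausdorff_space carrier;
  carrier_second_countable : @second_countable carrier;
  idx : Type;
  dom : idx -> set carrier;
  phi : idx -> carrier -> 'rV[R]_n;
  psi : idx -> 'rV[R]_n -> carrier;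
  dom_open : forall i, open (dom i);
  img_open : forall i, open (phi i @` dom i);
  phiK : forall i x, dom i x -> psi i (phi i x) = x;
  phi_continuous : forall i x, dom i x -> {for x, continuous (phi i)};
  psi_continuous : forall i u, (phi i @` dom i) u -> {for u, continuous (psi i)};
  phi_smooth : forall i j,
    smooth_on (phi i @` (dom i `&` dom j)) (phi j \o psi i);
  chart_at : carrier -> idx;
  dom_chart_at : forall x, dom (chart_at x) x
}.

Section Manifold.
Context (R : realType) (n : nat) (M : manifold R n).
Implicit Types (i : idx M) (x : M) (v w p : 'rV[R]_n) (U : set M).

(* The tangent and cotangent spaces at [x] are both represented by 'rV[R]_n:
   a vector [v] stands for \sum_l v_l d/dx^l and a covector [p] for
   \sum_l p_l dx^l, where (x^l) are the coordinates of the chart [chart_at x].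
   [tcoord i x v] and [ccoord i x p] are the components of the same vector
   (resp. covector) in an arbitrary chart [i] around [x], and [ccoord_inv i x]
   is the inverse of [ccoord i x]. *)
Definition tcoord i x v : 'rV[R]_n :=
  v *m 'J (phi i \o psi (chart_at x)) (phi (chart_at x) x).

Definition ccoord i x p : 'rV[R]_n :=
  p *m ('J (phi (chart_at x) \o psi i) (phi i x))^T.

Definition ccoord_inv i x p : 'rV[R]_n :=
  p *m ('J (phi i \o psi (chart_at x)) (phi (chart_at x) x))^T.

Definition pairing p v : R := (p *m v^T) 0 0.

Definition smooth_map (V : normedModType R) (A : set V) (f : V -> M) : Prop :=
  (forall u, A u -> {for u, continuous f}) /\
  forall i, smooth_on (A `&` f @^-1` dom i) (phi i \o f).

Definition smooth_fun U (f : M -> R) : Prop :=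
  forall i, smooth_on (phi i @` (U `&` dom i)) (f \o psi i).

(* Vector fields and 1-forms on [U] are total functions, used on [U] only. *)
Definition field_in i (X : M -> 'rV[R]_n) (u : 'rV[R]_n) : 'rV[R]_n :=
  tcoord i (psi i u) (X (psi i u)).

Definition form_in i (eta : M -> 'rV[R]_n) (u : 'rV[R]_n) : 'rV[R]_n :=
  ccoord i (psi i u) (eta (psi i u)).

Definition smooth_field U (X : M -> 'rV[R]_n) : Prop :=
  forall i, smooth_on (phi i @` (U `&` dom i)) (field_in i X).

Definition smooth_form U (eta : M -> 'rV[R]_n) : Prop :=
  forall i, smooth_on (phi i @` (U `&` dom i)) (form_in i eta).

(* v(f) for a tangent vector [v] at [x] *)
Definition dfun (f : M -> R) x v : R :=
  'D_v (f \o psi (chart_at x)) (phi (chart_at x) x).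

Definition bracket (X Y : M -> 'rV[R]_n) x : 'rV[R]_n :=
  'D_(X x) (field_in (chart_at x) Y) (phi (chart_at x) x)
  - 'D_(Y x) (field_in (chart_at x) X) (phi (chart_at x) x).

(* (d eta)_x(v, w)
   = \sum_(k, l) (d_k eta_l - d_l eta_k) v^k w^l *)
Definition dform (eta : M -> 'rV[R]_n) x v w : R :=
  pairing ('D_v (form_in (chart_at x) eta) (phi (chart_at x) x)) w
  - pairing ('D_w (form_in (chart_at x) eta) (phi (chart_at x) x)) v.

Definition inner (G : M -> 'M[R]_n) x v w : R := (v *m G x *m w^T) 0 0.

Record riemannian (G : M -> 'M[R]_n) : Prop := {
  metric_sym : forall x v w, inner G x v w = inner G x w v;
  metric_pos : forall x v, v != 0 -> 0 < inner G x v v;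
  metric_smooth : forall U X Y, open U -> smooth_field U X -> smooth_field U Y ->
    smooth_fun U (fun x => inner G x (X x) (Y x))
}.

(* [nabla x v Y] is the covariant derivative at [x], along the tangent vector
   [v], of a vector field [Y] that is smooth around [x]. *)
Record levi_civita (G : M -> 'M[R]_n)
    (nabla : M -> 'rV[R]_n -> (M -> 'rV[R]_n) -> 'rV[R]_n) : Prop := {
  nabla_linear : forall U Y x, open U -> smooth_field U Y -> U x ->
    forall (r : R) v w, nabla x (r *: v + w) Y = r *: nabla x v Y + nabla x w Y;
  nabla_add : forall U Y Z x, open U -> smooth_field U Y -> smooth_field U Z ->
    U x -> forall v,
    nabla x v (fun y => Y y + Z y) = nabla x v Y + nabla x v Z;
  nabla_leibniz : forall U f Y x, open U -> smooth_fun U f -> smooth_field U Y ->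
    U x -> forall v,
    nabla x v (fun y => f y *: Y y) = dfun f x v *: Y x + f x *: nabla x v Y;
  nabla_smooth : forall U X Y, open U -> smooth_field U X -> smooth_field U Y ->
    smooth_field U (fun x => nabla x (X x) Y);
  nabla_torsion_free : forall U X Y x, open U -> smooth_field U X ->
    smooth_field U Y -> U x ->
    nabla x (X x) Y - nabla x (Y x) X = bracket X Y x;
  nabla_metric : forall U Y Z x, open U -> smooth_field U Y ->
    smooth_field U Z -> U x -> forall v,
    dfun (fun y => inner G y (Y y) (Z y)) x v
    = inner G x (nabla x v Y) (Z x) + inner G x (Y x) (nabla x v Z)
}.

(* Subspaces are row spaces of matrices: Q_x is the row space of [Q x]. *)
Definition section_of (Q : M -> 'M[R]_n) (X : M -> 'rV[R]_n) : Prop :=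
  smooth_field setT X /\ forall x, (X x <= Q x)%MS.

Definition regular_distribution (k : nat) (Q : M -> 'M[R]_n) : Prop :=
  (forall x, \rank (Q x) = k) /\
  forall x v, (v <= Q x)%MS -> exists2 X, section_of Q X & X x = v.

(* Through every point there passes an integral manifold of [Q], given by an
   injective parametrization [f] whose differential at [u] has image Q_(f u)
   ([f] is then an immersion, since Q has rank [k]). *)
Definition integrable_distribution (k : nat) (Q : M -> 'M[R]_n) : Prop :=
  forall x, exists (A : set 'rV[R]_k) (f : 'rV[R]_k -> M),
    [/\ open A, A 0, f 0 = x & smooth_map A f] /\
    {in A &, injective f} /\
    forall u, A u -> (Q (f u) :=: 'J (phi (chart_at (f u)) \o f) u)%MS.

Section Projections.
Context (G Q : M -> 'M[R]_n).

Definition Qperp x : 'M[R]_n := kermx (G x *m (Q x)^T).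
Definition pi_Q x : 'M[R]_n := proj_mx (Q x) (Qperp x).
Definition pi_perp x : 'M[R]_n := proj_mx (Qperp x) (Q x).

Definition annih (S : M -> 'M[R]_n) x : 'M[R]_n := kermx (S x)^T.
Definition tau_perp x : 'M[R]_n := proj_mx (annih Q x) (annih Qperp x).

Definition flat x v : 'rV[R]_n := v *m G x.
Definition sharp x p : 'rV[R]_n := p *m invmx (G x).

Definition gmap x p : 'rV[R]_n := sharp x p *m pi_Q x.
Definition gbar x p p' : R := pairing p' (gmap x p).

(* i_v (d eta) *)
Definition deltaB x v (eta : M -> 'rV[R]_n) : 'rV[R]_n :=
  \row_l dform eta x v (delta_mx 0 l).

Definition nablaB x v (eta : M -> 'rV[R]_n) : 'rV[R]_n :=
  deltaB x v eta *m tau_perp x.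

Definition smooth_annih_form U (eta : M -> 'rV[R]_n) : Prop :=
  smooth_form U eta /\ forall x, U x -> (eta x <= annih Q x)%MS.

(* Pi^G(v, w) = z *)
Definition second_form (nabla : M -> 'rV[R]_n -> (M -> 'rV[R]_n) -> 'rV[R]_n)
    x v w (z : 'rV[R]_n) : Prop :=
  exists Y, [/\ section_of Q Y, Y x = w & z = nabla x v Y *m pi_perp x].

End Projections.

(* Curves [a, b] -> M and sections along them are represented by total
   functions on R that are smooth on an open interval containing [a, b] but
   used on [a, b] only. *)
Definition curve (a b : R) (c : R -> M) : Prop :=
  exists a' b', [/\ a' < a, b < b' & smooth_map `]a', b'[%classic c].

Definition covector_along (a b : R) (c : R -> M) (alpha : R -> 'rV[R]_n) : Prop :=
  exists a' b', [/\ a' < a, b < b', smooth_map `]a', b'[%classic c &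
    forall i, smooth_on (`]a', b'[%classic `&` c @^-1` dom i)
                        (fun t => ccoord i (c t) (alpha t))].

Definition vel (c : R -> M) (t : R) : 'rV[R]_n :=
  derive1 (phi (chart_at (c t)) \o c) t.

Definition tangent_curve (Q : M -> 'M[R]_n) (a b : R) (c : R -> M) : Prop :=
  curve a b c /\ forall t, a <= t <= b -> (vel c t <= Q (c t))%MS.

(* [W] is the derivative at [t], induced by the operator [D] on the local
   sections [S], of the section [s] along [c]: expand s = \sum_l f_l (e_l \o c)
   around [t] with [f_l] smooth functions and [e_l] local sections, and put
   W = \sum_l (f_l'(t) e_l(c t) + f_l(t) D_(c'(t)) e_l). *)
Definition along_deriv (S : set M -> (M -> 'rV[R]_n) -> Prop)
    (D : M -> 'rV[R]_n -> (M -> 'rV[R]_n) -> 'rV[R]_n)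
    (a b : R) (c : R -> M) (s : R -> 'rV[R]_n) (t : R) (W : 'rV[R]_n) : Prop :=
  exists (m : nat) (I : set R) (U : set M)
         (f : 'I_m -> R -> R) (e : 'I_m -> M -> 'rV[R]_n),
    [/\ open I, I t, open U & U (c t)] /\
    [/\ forall l, smooth_on I (f l),
        forall l, S U (e l),
        forall r, I r -> a <= r <= b -> s r = \sum_l f l r *: e l (c r) &
        W = \sum_l (derive1 (f l) t *: e l (c t)
                    + f l t *: D (c t) (vel c t) (e l))].

Definition nonholonomic (G Q : M -> 'M[R]_n)
    (nabla : M -> 'rV[R]_n -> (M -> 'rV[R]_n) -> 'rV[R]_n)
    (a b : R) (c : R -> M) : Prop :=
  tangent_curve Q a b c /\
  forall t, a <= t <= b -> exists2 W,
    along_deriv smooth_field nabla a b c (vel c) t W & W *m pi_Q G Q (c t) = 0.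

Definition hamiltonian (G Q : M -> 'M[R]_n) x p : R := 2^-1 * gbar G Q x p p.

(* The Hamiltonian in the canonical coordinates z = (q, p) on T*M defined by
   the chart [i]. *)
Definition hamiltonian_in (G Q : M -> 'M[R]_n) i
    (z : ('rV[R]_n * 'rV[R]_n)%type) : R :=
  hamiltonian G Q (psi i z.1) (ccoord_inv i (psi i z.1) z.2).

(* The canonical symplectic form \sum_l dq^l /\ dp_l *)
Definition omega (z z' : ('rV[R]_n * 'rV[R]_n)%type) : R :=
  pairing z'.2 z.1 - pairing z.2 z'.1.

(* Z = X_h(z), i.e. i_Z omega = dh at z *)
Definition hamiltonian_vector (h : 'rV[R]_n * 'rV[R]_n -> R)
    (z Z : ('rV[R]_n * 'rV[R]_n)%type) : Prop :=
  forall z', omega Z z' = 'D_z' h z.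

(* t |-> (c t, alpha t) is an integral curve of the Hamiltonian vector field
   on T*M that does not meet the zero section. *)
Definition normal_lift (G Q : M -> 'M[R]_n) (a b : R) (c : R -> M)
    (alpha : R -> 'rV[R]_n) : Prop :=
  covector_along a b c alpha /\
  forall t, a <= t <= b ->
    alpha t != 0 /\
    let i := chart_at (c t) in
    let q := phi i \o c in
    let p := fun r => ccoord i (c r) (alpha r) in
    hamiltonian_vector (hamiltonian_in G Q i) (q t, p t) (derive1 q t, derive1 p t).

Definition vakonomic (G Q : M -> 'M[R]_n) (a b : R) (c : R -> M) : Prop :=
  tangent_curve Q a b c /\ exists alpha, normal_lift G Q a b c alpha.

Definition lin_span (A : set 'rV[R]_n) : set 'rV[R]_n :=
  [set v | exists (m : nat) (r : 'I_m -> R) (w : 'I_m -> 'rV[R]_n),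
    (forall l, A (w l)) /\ v = \sum_l r l *: w l].

(* Q_x + [v, Q_x] *)
Definition bracket_span (Q : M -> 'M[R]_n) x v : set 'rV[R]_n :=
  lin_span [set w | exists Y X Y', [/\ section_of Q Y, section_of Q X,
    section_of Q Y', X x = v & w = Y x + bracket X Y' x]].

Definition compatible_section (G Q : M -> 'M[R]_n)
    (nabla : M -> 'rV[R]_n -> (M -> 'rV[R]_n) -> 'rV[R]_n)
    (a b : R) (c : R -> M) (eta : R -> 'rV[R]_n) : Prop :=
  [/\ covector_along a b c eta,
      forall t, a <= t <= b -> (eta t <= annih Q (c t))%MS,
      forall t, a <= t <= b -> exists2 z,
        second_form G Q nabla (c t) (vel c t) (vel c t) z &
        along_deriv (smooth_annih_form Q) (nablaB G Q) a b c eta t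
          (- flat G (c t) z) &
      forall t, a <= t <= b -> forall w, bracket_span Q (c t) (vel c t) w ->
        pairing (eta t) w = 0].

End Manifold.

(* Main.v *)
(** Write a covector along the curve as [alpha = flat c' + eta], where [eta] is
    a section of [Q^0] exactly when [g (alpha) = c'].  By an envelope argument,
    the derivative of the Hamiltonian in the base direction is computed with any
    section [X] of [Q] through [c'(t)], and Hamilton's equations become, for all
    local vector fields [Z],
      d/dt alpha(Z) = alpha([X, Z]) + Z(G(X, X)) / 2.
    For [Z] in [Q], torsion-freeness and metric compatibility turn this into
    [G(nabla_c' c', Z) = eta([X, Z])]; for [Z] in [Q^perp] it becomes
    [(nablaB_c' eta)(Z) = - G(Pi(c', c'), Z)].
    Hence along a curve with both properties [eta] annihilates [[c', Q]] and
    solves the equation of the statement, and either property together with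
    these two conditions on [eta] gives the other. *)

(* The envelope argument rests on the Legendre transform: half the cometric evaluated on [p] is the
   maximum of [p (X) - G (X, X) / 2] over [X] in [Q], reached at [X = g (p)]. At a maximum the
   variation of [X] with the base point has no first-order effect, so any section through [c'(t)]
   may replace [g (p)], and the derivative of the cometric never has to be computed. The defect in
   Hamilton's second equation is additive in its test vector, so test fields in [Q] and in [Q^perp]
   suffice. The nonvanishing of [c'] keeps the lift off the zero section, because [g (alpha) = c'].
   Two obstacles shape the analysis. Vectors and matrices at [x] are stored in the chart
   [chart_at x], which jumps with [x], so smoothness shows only after transport to a fixed chart.
   Equations along [c] hold only on [[a, b]], while the derivatives are two-sided; at an endpoint
   they are compared through one-sided limits. *)
Require Import Defs.
From HB Require Import structures.
From mathcomp Require Import all_boot all_order all_algebra.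
From mathcomp Require Import all_classical all_reals all_analysis.
From mathcomp Require Import ring lra.
Set Implicit Arguments.
Unset Strict Implicit.
Unset Printing Implicit Defensive.
Import Order.TTheory GRing.Theory Num.Theory.
Import numFieldNormedType.Exports.
Local Open Scope classical_set_scope.
Local Open Scope ring_scope.

(** * Smooth functions *)

Section CkLemmas.
Context {R : realType}.
Implicit Types (V W : normedModType R).

Lemma Ck_on_sub V W k (A B : set V) (f : V -> W) :
  B `<=` A -> Ck_on k A f -> Ck_on k B f.
Proof.
move=> BA; elim: k f => [|k IH] f /=; first by move=> H x /BA /H.
by move=> H v; have [H1 H2] := H v; split; [move=> x /BA /H1|exact: IH].
Qed.

(** Continuity and derivability at a point refer to the total function [f], so [Ck_on k A f] is a
    conjunction of conditions at the points of [A], and singletons are meaningful domains. *)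
Lemma Ck_on_pointwise V W k (A : set V) (f : V -> W) :
  (forall x, A x -> Ck_on k [set x] f) -> Ck_on k A f.
Proof.
elim: k f => [|k IH] f /= H; first by move=> x /H; exact.
move=> v; split; first by move=> x /H /(_ v) [+ _]; exact.
by apply: IH => x /H /(_ v) [].
Qed.

Lemma Ck_on_ext V W k (A : set V) (f g : V -> W) : open A ->
  (forall x, A x -> f x = g x) -> Ck_on k A f -> Ck_on k A g.
Proof.
move=> oA; elim: k f g => [|k IH] f g fg /=.
  move=> cf x Ax; have fgx : {near x, f =1 g}.
    by apply: filterS (open_nbhs_nbhs (conj oA Ax)) => y; exact: fg.
  have /= := cf _ Ax; rewrite /prop_for /continuous_at (fg _ Ax).
  by apply: cvg_trans; exact: near_eq_cvg.
move=> H v; have [d c] := H v.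
have fgx x : A x -> {near x, f =1 g}.
  by move=> Ax; apply: filterS (open_nbhs_nbhs (conj oA Ax)) => y; exact: fg.
split; first by move=> x Ax; apply: near_eq_derivable (fgx _ Ax) (d _ Ax).
apply: IH c => x Ax.
exact: near_eq_derive (fgx _ Ax).
Qed.

Lemma smooth_on_sub V W (A B : set V) (f : V -> W) :
  B `<=` A -> smooth_on A f -> smooth_on B f.
Proof. by move=> BA H k; exact: Ck_on_sub BA (H k). Qed.

Lemma smooth_on_ext V W (A : set V) (f g : V -> W) : open A ->
  (forall x, A x -> f x = g x) -> smooth_on A f -> smooth_on A g.
Proof. by move=> oA fg H k; exact: Ck_on_ext fg (H k). Qed.

Lemma smooth_on_local V W (A : set V) (f : V -> W) :
  (forall x, A x -> exists2 B, B x & smooth_on B f) -> smooth_on A f.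
Proof.
move=> H k; apply: Ck_on_pointwise => x /H [B Bx sB].
by apply: Ck_on_sub (sB k) => _ ->.
Qed.

Lemma smooth_on_continuous V W (A : set V) (f : V -> W) x :
  smooth_on A f -> A x -> {for x, continuous f}.
Proof. by move=> /(_ 0%N); exact. Qed.

Lemma smooth_on_derivable V W (A : set V) (f : V -> W) x v :
  smooth_on A f -> A x -> derivable f x v.
Proof. by move=> /(_ 1%N) /(_ v) [+ _]; exact. Qed.

Lemma smooth_on_derive V W (A : set V) (f : V -> W) v :
  smooth_on A f -> smooth_on A (fun x => 'D_v f x).
Proof. by move=> H k; have [] := H k.+1 v. Qed.

Lemma Ck_on_cst V W k (A : set V) (w : W) : Ck_on k A (fun _ => w).
Proof.
elim: k w => [|k IH] w /=; first by move=> x _; exact: cst_continuous.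
move=> v; split; first by move=> x _; exact: derivable_cst.
rewrite (_ : (fun x => 'D_v (fun _ => w) x) = (fun _ => 0)); first exact: IH.
by apply/funext => x; rewrite derive_cst.
Qed.

Lemma smooth_on_cst V W (A : set V) (w : W) : smooth_on A (fun _ => w).
Proof. by move=> k; exact: Ck_on_cst. Qed.

Lemma Ck_onD V W k (A : set V) (f g : V -> W) : open A ->
  Ck_on k A f -> Ck_on k A g -> Ck_on k A (fun x => f x + g x).
Proof.
move=> oA; elim: k f g => [|k IH] f g /=.
  by move=> cf cg x Ax; apply: continuousD; [exact: cf|exact: cg].
move=> Hf Hg v; have [df cf] := Hf v; have [dg cg] := Hg v; split.
  by move=> x Ax; apply: derivableD; [exact: df|exact: dg].
apply: Ck_on_ext (IH _ _ cf cg) => // x Ax.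
by rewrite deriveD; [|exact: df|exact: dg].
Qed.

Lemma smooth_onD V W (A : set V) (f g : V -> W) : open A ->
  smooth_on A f -> smooth_on A g -> smooth_on A (fun x => f x + g x).
Proof. by move=> oA Hf Hg k; exact: Ck_onD. Qed.

Lemma smooth_on_sum V W (I : Type) (r : seq I) (P : pred I) (A : set V)
    (f : I -> V -> W) : open A ->
  (forall i, P i -> smooth_on A (f i)) ->
  smooth_on A (fun x => \sum_(i <- r | P i) f i x).
Proof.
move=> oA H; elim: r => [|i r IH].
  rewrite (_ : (fun _ => _) = fun _ => 0); first exact: smooth_on_cst.
  by apply/funext => x; rewrite big_nil.
case Pi: (P i).
  rewrite (_ : (fun _ => _) = fun x => f i x + \sum_(i <- r | P i) f i x).
    by apply: smooth_onD => //; exact: H.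
  by apply/funext => x; rewrite big_cons Pi.
by rewrite (_ : (fun _ => _) = fun x => \sum_(i <- r | P i) f i x)//;
  apply/funext => x; rewrite big_cons Pi.
Qed.

(** [Ck_on k.+1] asks for continuity of the derivatives of order [k.+1] only, not of [f] itself. The
    Leibniz rule mixes all lower orders, so inductions on products run with this cumulative
    version. *)
Definition Ckle V W k (A : set V) (f : V -> W) :=
  forall j, (j <= k)%N -> Ck_on j A f.

Lemma CkleS V W k (A : set V) (f : V -> W) :
  Ckle k.+1 A f <-> Ckle 0 A f /\
   forall v, (forall x, A x -> derivable f x v) /\ Ckle k A (fun x => 'D_v f x).
Proof.
split.
  move=> H; split; first by move=> j; rewrite leqn0 => /eqP ->; exact: H.
  move=> v; split; first by have [] := H 1%N isT v.
  by move=> j jk; have [] := H j.+1 jk v.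
move=> [H0 H] [|j] jk; first exact: H0.
by move=> v; have [d c] := H v; split => //; exact: c.
Qed.

Lemma Ckle0 V W (A : set V) (f : V -> W) :
  Ckle 0 A f <-> forall x, A x -> {for x, continuous f}.
Proof.
by split=> [/(_ 0%N isT)//|H j]; rewrite leqn0 => /eqP ->.
Qed.

Lemma CkleW V W k (A : set V) (f : V -> W) : Ckle k.+1 A f -> Ckle k A f.
Proof. by move=> H j jk; apply: H; exact: leqW. Qed.

Lemma Ckle_ext V W k (A : set V) (f g : V -> W) : open A ->
  (forall x, A x -> f x = g x) -> Ckle k A f -> Ckle k A g.
Proof. by move=> oA fg H j jk; exact: Ck_on_ext fg (H j jk). Qed.

Lemma CkleD V W k (A : set V) (f g : V -> W) : open A ->
  Ckle k A f -> Ckle k A g -> Ckle k A (fun x => f x + g x).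
Proof. by move=> oA Hf Hg j jk; apply: Ck_onD; [|exact: Hf|exact: Hg]. Qed.

Lemma CkleM V k (A : set V) (f g : V -> R) : open A ->
  Ckle k A f -> Ckle k A g -> Ckle k A (fun x => f x * g x).
Proof.
move=> oA; elim: k f g => [|k IH] f g.
  move=> /Ckle0 cf /Ckle0 cg; apply/Ckle0 => x Ax.
  by apply: continuousM; [exact: cf|exact: cg].
move=> Hf Hg; apply/CkleS.
have [/Ckle0 cf df] := (CkleS _ _ _).1 Hf.
have [/Ckle0 cg dg] := (CkleS _ _ _).1 Hg.
split; first by apply/Ckle0 => x Ax; apply: continuousM; [exact: cf|exact: cg].
move=> v; have [dfv Cf] := df v; have [dgv Cg] := dg v; split.
  by move=> x Ax; apply: derivableM; [exact: dfv|exact: dgv].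
apply: (@Ckle_ext _ _ _ _ (fun x => f x * 'D_v g x + g x * 'D_v f x)) => //.
  by move=> x Ax; rewrite deriveM; [|exact: dfv|exact: dgv].
by apply: CkleD => //; apply: IH => //; exact: CkleW.
Qed.

Lemma smooth_onP V W (A : set V) (f : V -> W) :
  smooth_on A f <-> forall k, Ckle k A f.
Proof. by split=> [H k j _|H k]; [exact: H|exact: H]. Qed.

Lemma smooth_onM V (A : set V) (f g : V -> R) : open A ->
  smooth_on A f -> smooth_on A g -> smooth_on A (fun x => f x * g x).
Proof.
by move=> oA /smooth_onP Hf /smooth_onP Hg; apply/smooth_onP => k; exact: CkleM.
Qed.

Lemma smooth_on_prod V (I : Type) (r : seq I) (P : pred I) (A : set V)
    (f : I -> V -> R) : open A ->
  (forall i, P i -> smooth_on A (f i)) ->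
  smooth_on A (fun x => \prod_(i <- r | P i) f i x).
Proof.
move=> oA H; elim: r => [|i r IH].
  rewrite (_ : (fun _ => _) = fun _ => 1); first exact: smooth_on_cst.
  by apply/funext => x; rewrite big_nil.
case Pi: (P i).
  rewrite (_ : (fun _ => _) = fun x => f i x * \prod_(i <- r | P i) f i x).
    by apply: smooth_onM => //; exact: H.
  by apply/funext => x; rewrite big_cons Pi.
by rewrite (_ : (fun _ => _) = fun x => \prod_(i <- r | P i) f i x)//;
  apply/funext => x; rewrite big_cons Pi.
Qed.

Lemma smooth_onV V (A : set V) (f : V -> R) : open A ->
  (forall x, A x -> f x != 0) ->
  smooth_on A f -> smooth_on A (fun x => (f x)^-1).
Proof.
move=> oA f0 sf; apply/smooth_onP.
have c0 : forall x, A x -> {for x, continuous (fun x => (f x)^-1)}.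
  move=> x Ax; apply: (@continuousV _ _ f); first exact: f0.
  exact: smooth_on_continuous sf Ax.
have D v x : A x -> derivable (fun x => (f x)^-1) x v.
  by move=> Ax; apply: derivableV; [exact: f0|exact: smooth_on_derivable sf Ax].
elim=> [|k IH]; first exact/Ckle0.
apply/CkleS; split; first exact/Ckle0.
move=> v; split; first exact: D.
(* The derivative is a product in which only the inverse itself and a derivative of [f] occur, so
   the induction hypothesis controls it. *)
apply: (@Ckle_ext _ _ _ _ (fun x => (-1) * (((f x)^-1 * (f x)^-1) * 'D_v f x))) => //.
  move=> x Ax; rewrite deriveV; [|exact: f0|exact: smooth_on_derivable sf Ax].
  by rewrite -invfM -expr2 mulN1r scaleNr.
apply: CkleM => //; first by move=> j _; exact: Ck_on_cst.
apply: CkleM => //; first exact: CkleM.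
by move: sf => /smooth_on_derive /smooth_onP; exact.
Qed.

Lemma smooth_on_coordP V m n (A : set V) (f : V -> 'M[R]_(m, n)) : open A ->
  smooth_on A f <-> forall i j, smooth_on A (fun x => f x i j).
Proof.
move=> oA; split.
  move=> + i j k; move=> /(_ k); elim: k f => [|k IH] f /=.
    move=> cf x Ax; apply: (@continuous_comp _ _ _ f (fun M => M i j)); first exact: cf.
    exact: coord_continuous.
  move=> H v; have [d c] := H v; split.
    by move=> x Ax; move: (d x Ax) => /derivable_mxP; exact.
  apply: Ck_on_ext (IH _ c) => // x Ax.
  by rewrite derive_mx ?mxE//; exact: d.
move=> + k; elim: k f => [|k IH] f H /=.
  move=> x Ax; rewrite /continuous_at.
  apply/cvgrPdist_le => /= e e0.
  near=> y.
  rewrite /Num.Def.normr/= mx_normrE (bigmax_le _ (ltW e0))//= => i _.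
  rewrite !mxE/=.
  move: i; near: y; apply: filter_forall => /= i.
  have := H i.1 i.2 0%N x Ax.
  by move=> /cvgrPdist_le; exact.
move=> v.
have d x : A x -> derivable f x v.
  by move=> Ax; apply/derivable_mxP => i j; exact: smooth_on_derivable (H i j) Ax.
split; first exact: d.
apply: IH => i j.
apply: (@smooth_on_ext _ _ _ (fun x => 'D_v (fun x => f x i j) x)) => //.
  by move=> x Ax; rewrite derive_mx ?mxE//; exact: d.
exact: smooth_on_derive.
Unshelve. all: by end_near. Qed.

End CkLemmas.

(** * Functions with continuous partial derivatives are differentiable *)

Section C1.
Context {R : realType}.
Implicit Types (V W : normedModType R).

Lemma smooth_on_id V (A : set V) : smooth_on A (fun x : V => x).
Proof.
case=> [|k] /=; first by move=> x _.
move=> v; split; first by move=> x _; exact: derivable_id.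
rewrite (_ : (fun x => 'D_v (fun y : V => y) x) = fun _ => v); first exact: Ck_on_cst.
by apply/funext => x; rewrite derive_id.
Qed.

Lemma is_derive_line V W (f : V -> W) (a v : V) (s : R) :
  derivable f (s *: v + a) v ->
  is_derive s 1 (fun r : R => f (r *: v + a)) ('D_v f (s *: v + a)).
Proof.
have E : (fun h : R => h^-1 *: (((fun r : R => f (r *: v + a)) \o shift s) (h *: 1) - f (s *: v + a)))
   = (fun h : R => h^-1 *: ((f \o shift (s *: v + a)) (h *: v) - f (s *: v + a))).
  by apply/funext => h /=; rewrite [h%:A]mulr1 scalerDl addrA.
move=> d; split; first by rewrite /derivable E.
by rewrite /derive E.
Qed.

Lemma is_derive_mull (c s : R) : is_derive s 1 (fun r : R => c * r) c.
Proof.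
have := @is_deriveZ _ _ _ (@idfun R) c s 1 1 (is_derive_id s 1).
by rewrite [c *: 1]mulr1.
Qed.

Lemma derive_line0 V W (f : V -> W) (a v : V) :
  'D_v f a = derive1 (fun r : R => f (r *: v + a)) 0.
Proof.
rewrite /derive1 /derive.
have -> // : (fun h : R => h^-1 *: ((f \o shift a) (h *: v) - f a)) =
     (fun h => h^-1 *: (f ((h + 0) *: v + a) - f (0 *: v + a))).
by apply/funext => h; rewrite addr0 scale0r add0r.
Qed.

(** The mean value theorem on the segment from [y] to [c *: e + y], parametrised by [[0, 1]] so that
    both signs of [c] are treated at once. *)
Lemma mean_value_bound V (f : V -> R) (y e : V) (c D eps : R) :
  (forall s : R, 0 <= s <= 1 ->
     derivable f ((s * c) *: e + y) e /\ `|'D_e f ((s * c) *: e + y) - D| <= eps) ->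
  `|f (c *: e + y) - f y - c * D| <= eps * `|c|.
Proof.
move=> H.
pose g := fun s : R => f (s *: (c *: e) + y).
have Hd (s : R) : 0 <= s <= 1 -> is_derive s 1 g (c * 'D_e f ((s * c) *: e + y)).
  move=> /H [d _].
  have E : g = (fun r => f (r *: e + y)) \o (fun r => c * r).
    by apply/funext => r; rewrite /g /= scalerA mulrC.
  rewrite mulrC in d.
  have [d1 d2] := is_derive_line d.
  split.
    rewrite E; apply/derivable1_diffP/differentiable_comp; last exact/derivable1_diffP.
    by apply/derivable1_diffP; have [] := is_derive_mull c s.
  have [m1 m2] := is_derive_mull c s.
  rewrite E -derive1E (derive1_comp m1 d1) [derive1 ( *%R c) _]derive1E m2.
  by rewrite derive1E d2 (mulrC s c) [LHS]mulrC.
have [|s|t] := @MVT R g (fun s => c * 'D_e f ((s * c) *: e + y)) 0 1 ltr01.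
- by move=> s; rewrite in_itv/= => /andP[s0 s1]; apply: Hd; rewrite !ltW.
- apply: derivable_within_continuous => x; rewrite in_itv/= => x01.
  by have [] := Hd _ x01.
rewrite in_itv/= => /andP[t0 t1]; rewrite subr0 mulr1 /g scale1r scale0r add0r => ->.
have [|_ ht] := H t; first by rewrite !ltW.
by rewrite -mulrBr normrM mulrC ler_wpM2r.
Qed.

Section Gradient.
Context {m : nat} (D : 'I_m -> R).

Definition gradient_map (h : 'rV[R]_m) : R := \sum_l h 0 l * D l.

Fact gradient_map_linear : linear gradient_map.
Proof.
move=> c u v; rewrite /gradient_map scaler_sumr -big_split; apply: eq_bigr => l _.
by rewrite !mxE mulrDl -mulrA.
Qed.

HB.instance Definition _ :=
  GRing.isLinear.Build R 'rV[R]_m R _ gradient_map gradient_map_linear.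

Lemma gradient_map_continuous : continuous gradient_map.
Proof.
move=> x; apply: (@smooth_on_continuous _ _ _ setT) => //.
apply: smooth_on_sum; first exact: openT.
move=> l _; apply: smooth_onM; [exact: openT| |exact: smooth_on_cst].
by move: (@smooth_on_id 'rV[R]_m setT) => /smooth_on_coordP; apply; exact: openT.
Qed.

End Gradient.

Lemma differentiable_from V W (f : V -> W) (df : {linear V -> W}) (x : V) :
  continuous df -> f \o shift x = cst (f x) + df +o_ 0 id -> differentiable f x.
Proof.
move=> dfc dxf; apply/diff_locallyP.
by rewrite (diff_unique dfc dxf).
Qed.

Lemma row_head_step m (h : 'rV[R]_m) (l : 'I_m) :
  \row_j (if (j < l.+1)%N then h 0 j else 0) =
  h 0 l *: delta_mx 0 l + \row_j (if (j < l)%N then h 0 j else 0).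
Proof.
apply/rowP => j; rewrite !mxE eqxx /= ltnS leq_eqVlt -(inj_eq val_inj) /=.
by case: (ltngtP j l) => [||/val_inj ->] /=; rewrite ?mulr0 ?add0r ?mulr1 ?addr0.
Qed.

(** One goes from [x] to [h + x] by changing one coordinate at a time. Each leg is parallel to an
    axis, and [mean_value_bound] compares the increment along it with the partial derivative at
    [x]. *)
Lemma C1_differentiable m (A : set 'rV[R]_m) (f : 'rV[R]_m -> R) x :
  open A -> A x -> Ck_on 1 A f -> differentiable f x.
Proof.
move=> oA Ax C1.
pose D := fun l : 'I_m => 'D_(delta_mx 0 l) f x.
apply: (@differentiable_from _ _ _ (gradient_map D)); first exact: gradient_map_continuous.
apply/eqaddoP => _/posnumP[e].
(* Each of the [m] legs costs at most [e' * |h|]; dividing by [m.+1] also covers [m = 0]. *)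
pose e' := e%:num / m.+1%:R.
have e'0 : 0 < e' by rewrite divr_gt0.
have near_x : \forall y \near x, forall l : 'I_m,
    A y /\ `|'D_(delta_mx 0 l) f y - D l| <= e'.
  apply: (@filter_forall _ 'I_m (fun l y => A y /\ `|'D_(delta_mx 0 l) f y - D l| <= e') (nbhs x) (nbhs_filter x)).
  move=> l; near=> y; split.
    by near: y; exact: open_nbhs_nbhs.
  rewrite distrC; near: y.
  by have [_ /(_ x Ax)] := C1 (delta_mx 0 l); move=> /cvgrPdist_le; exact.
have /nbhs_ballP[d /= d0 Hd] := near_x.
near=> h.
have hd : `|h| < d.
  rewrite -[h]opprK normrN -sub0r; near: h.
  by apply/nbhs_ballP; exists d => //= z; rewrite -ball_normE.
pose y l := \row_j (if (j < l)%N then h 0 j else 0) + x.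
(* The norm is the maximum norm and every coordinate of the displacement is at most that of [h], so
   all legs stay in the ball. *)
have inball l (s : R) : 0 <= s <= 1 ->
    ball x d ((s * h 0 l) *: delta_mx 0 l + y (val l)).
  move=> /andP[s0 s1]; rewrite -ball_normE /= addrA opprD addrCA subrr addr0 normrN.
  apply: (le_lt_trans _ hd).
  rewrite /Num.Def.normr/= !mx_normrE.
  apply: bigmax_le; first by rewrite -mx_normrE; exact: (normr_ge0 h).
  move=> [i j] _ /=; rewrite !mxE !ord1 eqxx /=.
  apply: (@le_trans _ _ `|h 0 j|).
    case: (ltngtP j l) => [lt|gt|/val_inj ->].
    - by rewrite -(inj_eq val_inj) (ltn_eqF lt) mulr0 add0r.
    - by rewrite -(inj_eq val_inj) (gtn_eqF gt) mulr0 add0r normr0.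
    - by rewrite eqxx mulr1 addr0 normrM ger0_norm// ler_piMl.
  by apply: (@le_bigmax _ _ _ 0 (fun i : 'I_1 * 'I_m => `|h i.1 i.2|) (0, j)).
have hj j : `|h 0 j| <= `|h|.
  rewrite [leRHS]/Num.Def.normr/= mx_normrE.
  by apply: (@le_bigmax _ _ _ 0 (fun i : 'I_1 * 'I_m => `|h i.1 i.2|) (0, j)).
have step l : (l <= m)%N ->
  `|f (y l) - f x - \sum_(j < m | (j < l)%N) h 0 j * D j| <= l%:R * (e' * `|h|).
  elim: l => [_|l IH lm].
    rewrite big_pred0 // /y (_ : \row_j _ = 0) ?add0r ?subrr ?subr0 ?normr0 ?mul0r//.
    by apply/rowP => j; rewrite !mxE.
  pose i := Ordinal lm.
  rewrite (bigD1 i) //= (eq_bigl (fun j : 'I_m => (j < l)%N)); last first.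
    by move=> j; rewrite -(inj_eq val_inj) /= ltnS andbC ltn_neqAle.
  have -> : y l.+1 = h 0 i *: delta_mx 0 i + y l by rewrite /y (row_head_step h i) addrA.
  set S := \sum_(_ < _ | _) _; set fy := f (_ + _).
  rewrite (_ : _ - _ = (fy - f (y l) - h 0 i * D i) + (f (y l) - f x - S)); last first.
    by ring.
  apply: (le_trans (ler_normD _ _)); rewrite -natr1 mulrDl mul1r addrC.
  apply: lerD; first by apply: IH; exact: ltnW.
  apply: (@le_trans _ _ (e' * `|h 0 i|)); last by rewrite ler_pM2l.
  apply: mean_value_bound => s s01; have [As Ds] := Hd _ (inball i s s01) i.
  by split => //; have [+ _] := C1 (delta_mx 0 i); exact.
have := step m (leqnn m).
rewrite (_ : y m = h + x); last first.
  by rewrite /y; congr (_ + _); apply/rowP => j; rewrite mxE ltn_ord.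
rewrite (eq_bigl xpredT) => [|j]; last by rewrite ltn_ord.
move=> hm; rewrite opprD addrA; apply: (le_trans hm).
rewrite mulrA ler_wpM2r // /e' mulrCA -[leRHS]mulr1 ler_pM2l // ler_pdivrMr// mul1r.
by rewrite ler_nat.
Unshelve. all: by end_near. Qed.

End C1.

(** * Composition of smooth functions *)

Section Composition.
Context {R : realType}.
Implicit Types (V W : normedModType R).

Lemma smooth_on_differentiable m n (A : set 'rV[R]_m) (f : 'rV[R]_m -> 'rV[R]_n) x :
  open A -> smooth_on A f -> A x -> differentiable f x.
Proof.
move=> oA /(smooth_on_coordP _ oA) sf Ax.
have -> : f = \sum_(j < n) (fun x => f x 0 j *: (delta_mx 0 j : 'rV[R]_n)).
  by apply/funext => y; rewrite fct_sumE [LHS]row_sum_delta.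
apply: differentiable_sum => j; apply: differentiableZl.
exact: C1_differentiable (sf 0 j 1%N).
Qed.

Lemma derive_coord m (f : 'rV[R]_m -> R) (y w : 'rV[R]_m) : differentiable f y ->
  'D_w f y = \sum_l w 0 l * 'D_(delta_mx 0 l) f y.
Proof.
move=> df; rewrite deriveE // [w in LHS]row_sum_delta linear_sum; apply: eq_bigr => l _.
by rewrite linearZ deriveE.
Qed.

(** The inner map is only known to be derivable in the direction [v]. Restricted to a line it
    becomes a function of a real variable, for which derivability is differentiability, and the
    usual chain rule applies. *)
Lemma is_derive_compose V W1 W (h : V -> W1) (f : W1 -> W) x v :
  derivable h x v -> differentiable f (h x) ->
  is_derive x v (fun y => f (h y)) ('D_('D_v h x) f (h x)).
Proof.
move=> dh df.
have d0 : derivable h (0 *: v + x) v by rewrite scale0r add0r.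
have [g1 g2] := is_derive_line d0.
move: (g1) => /derivable1_diffP g3.
have df' : differentiable f (h (0 *: v + x)) by rewrite scale0r add0r.
have dfg := @differentiable_comp R R W1 W (fun r : R => h (r *: v + x)) f 0 g3 df'.
split; first exact/derivable1P/derivable1_diffP.
rewrite derive_line0 derive1E (deriveE _ dfg) (diff_comp g3 df') /=.
rewrite deriveE //.
by rewrite -(deriveE _ g3) g2 scale0r add0r.
Qed.

Lemma Ckle_cst V W k (A : set V) (w : W) : Ckle k A (fun _ => w).
Proof. by move=> j _; exact: Ck_on_cst. Qed.

Lemma Ckle_sum V W (I : Type) (r : seq I) k (A : set V)
    (f : I -> V -> W) : open A ->
  (forall i, Ckle k A (f i)) ->
  Ckle k A (fun x => \sum_(i <- r) f i x).
Proof.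
move=> oA H; elim: r => [|i r IH].
  rewrite (_ : (fun _ => _) = fun _ => 0); first exact: Ckle_cst.
  by apply/funext => x; rewrite big_nil.
rewrite (_ : (fun _ => _) = fun x => f i x + \sum_(i <- r) f i x).
  exact: CkleD.
by apply/funext => x; rewrite big_cons.
Qed.

(** The induction quantifies over [f]: a derivative of the composite is a sum of products of a
    derivative of [h] with a partial derivative of [f] composed with [h], and that partial
    derivative is smooth again. *)
Lemma smooth_on_compose V m (A : set V) (B : set 'rV[R]_m)
    (h : V -> 'rV[R]_m) (f : 'rV[R]_m -> R) : open A -> open B ->
  (forall x, A x -> B (h x)) -> smooth_on A h -> smooth_on B f ->
  smooth_on A (fun x => f (h x)).
Proof.
move=> oA oB AB sh sf; apply/smooth_onP => k; elim: k f sf => [|k IH] f sf.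
  apply/Ckle0 => x Ax; apply: (@continuous_comp _ _ _ h f).
    exact: smooth_on_continuous sh Ax.
  by apply: smooth_on_continuous sf _; exact: AB.
have c0 : Ckle 0 A (fun x => f (h x)).
  apply/Ckle0 => x Ax; apply: (@continuous_comp _ _ _ h f).
    exact: smooth_on_continuous sh Ax.
  by apply: smooth_on_continuous sf _; exact: AB.
have df x : A x -> differentiable f (h x).
  by move=> Ax; apply: C1_differentiable (sf 1%N); [|exact: AB].
have D v x : A x -> is_derive x v (fun y => f (h y)) ('D_('D_v h x) f (h x)).
  move=> Ax; apply: is_derive_compose; last exact: df.
  exact: smooth_on_derivable sh Ax.
apply/CkleS; split => // v; split; first by move=> x /(D v) [].
apply: (@Ckle_ext _ _ _ _ _ (fun x => \sum_l 'D_v h x 0 l * 'D_(delta_mx 0 l) f (h x))) => //.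
  by move=> x Ax; have [_ ->] := D v x Ax; rewrite derive_coord //; exact: df.
apply: Ckle_sum => // l.
apply: CkleM => //; last first.
  by apply: (IH (fun y => 'D_(delta_mx 0 l) f y)); exact: smooth_on_derive.
have /(smooth_on_coordP _ oA) /(_ 0 l) := smooth_on_derive v sh.
by move=> /smooth_onP; exact.
Qed.

Lemma smooth_on_compose_row V m n (A : set V) (B : set 'rV[R]_m)
    (h : V -> 'rV[R]_m) (f : 'rV[R]_m -> 'rV[R]_n) : open A -> open B ->
  (forall x, A x -> B (h x)) -> smooth_on A h -> smooth_on B f ->
  smooth_on A (fun x => f (h x)).
Proof.
move=> oA oB AB sh /(smooth_on_coordP _ oB) sf; apply/(smooth_on_coordP _ oA) => i j.
exact: (smooth_on_compose oA oB AB sh (sf i j)).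
Qed.

End Composition.

(** * Matrices depending smoothly on a parameter *)

Section SmoothMatrices.
Context {R : realType} {V : normedModType R} (A : set V) (oA : open A).

Definition msmooth m n (F : V -> 'M[R]_(m, n)) :=
  forall i j, smooth_on A (fun x => F x i j).

Lemma msmoothM m n p (F : V -> 'M[R]_(m, n)) (H : V -> 'M[R]_(n, p)) :
  msmooth F -> msmooth H -> msmooth (fun x => F x *m H x).
Proof.
move=> sF sH i j.
apply: (@smooth_on_ext _ _ _ _ (fun x => \sum_l F x i l * H x l j)) => //.
  by move=> x _; rewrite mxE.
by apply: smooth_on_sum => // l _; exact: smooth_onM.
Qed.

Lemma msmooth_tr m n (F : V -> 'M[R]_(m, n)) :
  msmooth F -> msmooth (fun x => (F x)^T).
Proof.
move=> sF i j; apply: (@smooth_on_ext _ _ _ _ (fun x => F x j i)) => //.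
by move=> x _; rewrite mxE.
Qed.

Lemma msmoothB m n (F H : V -> 'M[R]_(m, n)) :
  msmooth F -> msmooth H -> msmooth (fun x => F x - H x).
Proof.
move=> sF sH i j; apply: (@smooth_on_ext _ _ _ _ (fun x => F x i j + (-1) * H x i j)) => //.
  by move=> x _; rewrite !mxE mulN1r.
apply: smooth_onD => //; apply: smooth_onM => //; exact: smooth_on_cst.
Qed.

Lemma msmooth_cst m n (F : 'M[R]_(m, n)) : msmooth (fun _ => F).
Proof. by move=> i j; exact: smooth_on_cst. Qed.

Lemma smooth_on_det n (F : V -> 'M[R]_n) :
  msmooth F -> smooth_on A (fun x => \det (F x)).
Proof.
move=> sF; apply: smooth_on_sum => // s _.
apply: smooth_onM => //; first exact: smooth_on_cst.
by apply: smooth_on_prod.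
Qed.

(** By Cramer's rule the entries of the inverse are cofactors divided by the determinant. *)
Lemma msmooth_inv n (F : V -> 'M[R]_n) :
  (forall x, A x -> F x \in unitmx) -> msmooth F -> msmooth (fun x => invmx (F x)).
Proof.
move=> uF sF i j.
have sd : smooth_on A (fun x => \det (F x)) by exact: smooth_on_det.
apply: (@smooth_on_ext _ _ _ _ (fun x => (\det (F x))^-1 *
    ((-1) ^+ (j + i) * \det (row' j (col' i (F x)))))) => //.
  by move=> x Ax; rewrite /invmx uF // !mxE.
apply: smooth_onM => //.
  apply: smooth_onV => // x Ax; rewrite -unitfE -unitmxE; exact: uF.
apply: smooth_onM => //; first exact: smooth_on_cst.
apply: smooth_on_det => a b.
apply: (@smooth_on_ext _ _ _ _ (fun x => F x (lift j a) (lift i b))) => //.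
by move=> x _; rewrite !mxE.
Qed.

Lemma msmooth_rowP n (F : V -> 'rV[R]_n) : msmooth F <-> smooth_on A F.
Proof. by split=> [?|?]; [exact/smooth_on_coordP|exact/smooth_on_coordP]. Qed.

End SmoothMatrices.

(** * Charts *)

(* Locked, because unification otherwise unfolds Jacobians of distinct
   transition maps when it compares them. *)
HB.lock Definition Jac (R : realType) (n : nat) (M : manifold R n)
  (i j : idx M) (x : M) : 'M[R]_n := 'J (phi j \o psi i) (phi i x).
Arguments Jac {R n M} i j x.

Section Charts.
Context {R : realType} {n : nat} {M : manifold R n}.
Implicit Types (i j l : idx M) (x y : M) (U : set M).

Lemma psi_dom i u : (phi i @` dom i) u -> dom i (psi i u).
Proof. by move=> [x dx <-]; rewrite phiK. Qed.

Lemma psiK i u : (phi i @` dom i) u -> phi i (psi i u) = u.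
Proof. by move=> [x dx <-]; rewrite phiK. Qed.

Lemma chart_imageE i U u :
  (phi i @` (U `&` dom i)) u <-> (phi i @` dom i) u /\ U (psi i u).
Proof.
split=> [[x [Ux dx] <-]|]; first by rewrite phiK //; split => //; exists x.
by case=> -[x dx <-]; rewrite phiK // => Ux; exists x.
Qed.

Lemma open_chart_image i U : open U -> open (phi i @` (U `&` dom i)).
Proof.
move=> oU; rewrite openE => u /chart_imageE [iu Uu].
have cu := psi_continuous iu.
have nU : nbhs u (psi i @^-1` U) by apply: cu; exact: open_nbhs_nbhs.
have ni : nbhs u (phi i @` dom i) by apply: open_nbhs_nbhs; split => //; exact: img_open.
by apply: filterS (filterI ni nU) => v [iv Uv]; apply/chart_imageE.
Qed.

Lemma transition_differentiable i j x : dom i x -> dom j x ->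
  differentiable (phi j \o psi i) (phi i x).
Proof.
move=> ix jx; apply: (smooth_on_differentiable _ (@phi_smooth _ _ _ i j)).
  by rewrite setIC; apply: open_chart_image; exact: dom_open.
by exists x.
Qed.

Lemma mul_Jac i j x v : dom i x -> dom j x ->
  v *m Jac i j x = 'D_v (phi j \o psi i) (phi i x).
Proof.
by move=> ix jx; rewrite Jac.unlock deriveEjacobian //; exact: transition_differentiable.
Qed.

Lemma near_chart_image i x U : dom i x -> open U -> U x ->
  \forall u \near phi i x, (phi i @` (U `&` dom i)) u.
Proof.
by move=> ix oU Ux; apply: open_nbhs_nbhs; split; [exact: open_chart_image|exists x].
Qed.

Lemma Jac_id i x : dom i x -> Jac i i x = 1%:M.
Proof.
move=> ix; apply/row_matrixP => a; rewrite !rowE mul_Jac //.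
rewrite (@near_eq_derive _ _ _ _ id).
  by rewrite derive_id mulmx1.
have := near_chart_image ix (@dom_open _ _ _ i) ix.
by apply: filterS => u /chart_imageE [iu _] /=; rewrite psiK.
Qed.

Lemma Jac_comp i j l x : dom i x -> dom j x -> dom l x ->
  Jac i j x *m Jac j l x = Jac i l x.
Proof.
move=> ix jx lx; apply/row_matrixP => a; rewrite !rowE mulmxA.
rewrite (mul_Jac _ ix jx) (mul_Jac _ jx lx) (mul_Jac _ ix lx).
have dj := transition_differentiable ix jx.
have dl : differentiable (phi l \o psi j) ((phi j \o psi i) (phi i x)).
  by rewrite /= (phiK ix); exact: transition_differentiable.
have dj' : derivable (phi j \o psi i) (phi i x) (delta_mx 0 a) by exact: diff_derivable.
have [_] := is_derive_compose dj' dl.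
rewrite /= (phiK ix) => <-; apply: near_eq_derive.
have := near_chart_image ix (@dom_open _ _ _ j) jx.
by apply: filterS => u /chart_imageE [iu ju] /=; rewrite phiK.
Qed.

Lemma Jac_sym i j x : dom i x -> dom j x -> Jac i j x *m Jac j i x = 1%:M.
Proof. by move=> ix jx; rewrite Jac_comp // Jac_id. Qed.

Lemma tcoordE i x v : tcoord i x v = v *m Jac (chart_at x) i x.
Proof. by rewrite Jac.unlock. Qed.

Lemma ccoordE i x p : ccoord i x p = p *m (Jac i (chart_at x) x)^T.
Proof. by rewrite Jac.unlock. Qed.

Lemma ccoord_invE i x p : ccoord_inv i x p = p *m (Jac (chart_at x) i x)^T.
Proof. by rewrite Jac.unlock. Qed.

Lemma tcoord_at x v : tcoord (chart_at x) x v = v.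
Proof. by rewrite tcoordE Jac_id ?mulmx1 //; exact: dom_chart_at. Qed.

Lemma ccoord_at x p : ccoord (chart_at x) x p = p.
Proof. by rewrite ccoordE Jac_id ?trmx1 ?mulmx1 //; exact: dom_chart_at. Qed.

Lemma tcoord_change i j x v : dom i x -> dom j x ->
  tcoord j x v = tcoord i x v *m Jac i j x.
Proof.
by move=> ix jx; rewrite !tcoordE -mulmxA Jac_comp //; exact: dom_chart_at.
Qed.

Lemma ccoord_change i j x p : dom i x -> dom j x ->
  ccoord j x p = ccoord i x p *m (Jac j i x)^T.
Proof.
by move=> ix jx; rewrite !ccoordE -mulmxA -trmx_mul Jac_comp //; exact: dom_chart_at.
Qed.

Lemma ccoordK i x p : dom i x -> ccoord_inv i x (ccoord i x p) = p.
Proof.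
move=> ix; rewrite ccoord_invE ccoordE -mulmxA -trmx_mul Jac_sym ?trmx1 ?mulmx1 //.
exact: dom_chart_at.
Qed.

Lemma ccoord_invK i x p : dom i x -> ccoord i x (ccoord_inv i x p) = p.
Proof.
move=> ix; rewrite ccoord_invE ccoordE -mulmxA -trmx_mul Jac_sym ?trmx1 ?mulmx1 //.
exact: dom_chart_at.
Qed.

Definition tcoord_inv i x (v : 'rV[R]_n) := v *m Jac i (chart_at x) x.

Lemma tcoord_invK i x v : dom i x -> tcoord i x (tcoord_inv i x v) = v.
Proof.
move=> ix; rewrite tcoordE -mulmxA Jac_sym ?mulmx1 //; exact: dom_chart_at.
Qed.

Lemma tcoordK i x v : dom i x -> tcoord_inv i x (tcoord i x v) = v.
Proof.
move=> ix; rewrite /tcoord_inv tcoordE -mulmxA Jac_sym ?mulmx1 //; exact: dom_chart_at.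
Qed.

Lemma pairing_coord i x p v : dom i x ->
  pairing (ccoord i x p) (tcoord i x v) = pairing p v.
Proof.
move=> ix; rewrite /pairing ccoordE tcoordE trmx_mul mulmxA -(mulmxA p) -trmx_mul.
by rewrite Jac_sym ?trmx1 ?mulmx1 //; exact: dom_chart_at.
Qed.

Lemma smooth_transition_jacobian i j :
  msmooth (phi i @` (dom j `&` dom i)) (fun u => 'J (phi j \o psi i) u).
Proof.
move=> a b; have oA := @open_chart_image i _ (@dom_open _ _ M j).
have st := @phi_smooth _ _ M i j; rewrite setIC in st.
apply: (@smooth_on_ext _ _ _ _ (fun u => ('D_(delta_mx 0 a) (phi j \o psi i) u) 0 b)) => //.
  move=> u Au; rewrite deriveEjacobian; last exact: smooth_on_differentiable oA st Au.
  by rewrite -rowE mxE.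
by have /(smooth_on_coordP _ oA) := smooth_on_derive (delta_mx 0 a) st.
Qed.

(** One chart containing [U] decides: the components in another chart are these, composed with the
    transition map and multiplied by its Jacobian. *)
Lemma smooth_field_chart i U (X : M -> 'rV[R]_n) : open U -> U `<=` dom i ->
  smooth_on (phi i @` U) (field_in i X) -> smooth_field U X.
Proof.
move=> oU Ui sX j.
have UI : U `&` dom i = U by apply/setIidPl.
have oA := @open_chart_image j _ oU.
have oB : open (phi i @` U) by rewrite -UI; exact: open_chart_image.
have st := @phi_smooth _ _ M j i.
have sA : smooth_on (phi j @` (U `&` dom j)) (phi i \o psi j).
  by apply: smooth_on_sub st; move=> _ [x [Ux jx] <-]; exists x; split => //; exact: Ui.
have AB u : (phi j @` (U `&` dom j)) u -> (phi i @` U) ((phi i \o psi j) u).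
  by move=> [x [Ux jx] <-] /=; rewrite phiK //; exists x.
have E u : (phi j @` (U `&` dom j)) u ->
   field_in i X ((phi i \o psi j) u) *m 'J (phi j \o psi i) ((phi i \o psi j) u)
   = field_in j X u.
  move=>  [x [Ux jx] <-] /=; rewrite /field_in !(phiK jx) !(phiK (Ui _ Ux)).
  by rewrite (tcoord_change _ (Ui _ Ux) jx) Jac.unlock.
apply: (smooth_on_ext oA E); apply/(msmooth_rowP oA); apply: (msmoothM oA).
  by apply/(msmooth_rowP oA); apply: (smooth_on_compose_row oA oB AB sA sX).
move=> a b; apply: (smooth_on_compose oA _ _ sA (smooth_transition_jacobian i j a b)).
  by apply: open_chart_image; exact: dom_open.
by move=> u [x [Ux jx] <-] /=; rewrite phiK //; exists x => //; split => //; exact: Ui.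
Qed.

Lemma smooth_form_chart i U (eta : M -> 'rV[R]_n) : open U -> U `<=` dom i ->
  smooth_on (phi i @` U) (form_in i eta) -> smooth_form U eta.
Proof.
move=> oU Ui sX j.
have UI : U `&` dom i = U by apply/setIidPl.
have oA := @open_chart_image j _ oU.
have oB : open (phi i @` U) by rewrite -UI; exact: open_chart_image.
have st := @phi_smooth _ _ M j i.
have sA : smooth_on (phi j @` (U `&` dom j)) (phi i \o psi j).
  by apply: smooth_on_sub st; move=> _ [x [Ux jx] <-]; exists x; split => //; exact: Ui.
have AB u : (phi j @` (U `&` dom j)) u -> (phi i @` U) ((phi i \o psi j) u).
  by move=> [x [Ux jx] <-] /=; rewrite phiK //; exists x.
have E u : (phi j @` (U `&` dom j)) u ->
   form_in i eta ((phi i \o psi j) u) *m ('J (phi i \o psi j) u)^T = form_in j eta u.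
  move=>  [x [Ux jx] <-] /=; rewrite /form_in !(phiK jx) !(phiK (Ui _ Ux)).
  by rewrite (ccoord_change _ (Ui _ Ux) jx) Jac.unlock.
apply: (smooth_on_ext oA E); apply/(msmooth_rowP oA); apply: (msmoothM oA).
  by apply/(msmooth_rowP oA); apply: (smooth_on_compose_row oA oB AB sA sX).
apply: (msmooth_tr oA) => a b; apply: smooth_on_sub (smooth_transition_jacobian j i a b).
by move=> _ [x [Ux jx] <-]; exists x => //; split => //; exact: Ui.
Qed.

Lemma smooth_field_sub U V (X : M -> 'rV[R]_n) : V `<=` U ->
  smooth_field U X -> smooth_field V X.
Proof.
by move=> VU sX i; apply: smooth_on_sub (sX i); apply: image_subset => x [/VU].
Qed.

(** The field with constant components [w] in the chart [i]. For [w] in the standard basis these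
    fields read off the entries of the metric and expand velocities. *)
Definition coord_field i (w : 'rV[R]_n) x : 'rV[R]_n := tcoord_inv i x w.

Lemma smooth_coord_field i w : smooth_field (dom i) (coord_field i w).
Proof.
apply: (@smooth_field_chart i) => //; first exact: dom_open.
have oA : open (phi i @` dom i) by exact: img_open.
apply: (@smooth_on_ext _ _ _ _ (fun=> w)) => //; last exact: smooth_on_cst.
by move=> u iu; rewrite /field_in tcoord_invK //; exact: psi_dom.
Qed.

Lemma near_dom i x : dom i x -> \forall u \near phi i x, (phi i @` dom i) u.
Proof.
by move=> ix; apply: open_nbhs_nbhs; split; [exact: img_open|exists x].
Qed.

End Charts.

(** * Orthogonal projections *)

Section OrthogonalProjection.
Context {R : realType} {n : nat} (G Q : 'M[R]_n).
Hypothesis symG : G^T = G.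
Hypothesis posG : forall v : 'rV[R]_n, v != 0 -> 0 < (v *m G *m v^T) 0 0.

Let Qp : 'M[R]_n := kermx (G *m Q^T).
Let P := proj_mx Q Qp.
Let Pp := proj_mx Qp Q.

Lemma metric_unit : G \in unitmx.
Proof.
rewrite -row_free_unit; apply/row_freeP; apply: contrapT => nf.
have : ~~ row_free G by apply/negP => /row_freeP.
rewrite -kermx_eq0 => /rowV0Pn[v /sub_kermxP vG v0].
by have := posG v0; rewrite vG mul0mx mxE ltxx.
Qed.

Lemma orth_sub (v w : 'rV[R]_n) :
  (v <= Qp)%MS -> (w <= Q)%MS -> v *m G *m w^T = 0.
Proof.
move=> /sub_kermxP vQ /submxP[a ->].
by rewrite trmx_mul mulmxA -(mulmxA v) vQ mul0mx.
Qed.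

Lemma cap_orth : (Q :&: Qp)%MS = 0.
Proof.
apply/eqP/rowV0P => v; rewrite sub_capmx => /andP[vQ vQp].
have := orth_sub vQp vQ; apply: contra_eq => v0.
by apply/eqP => /matrixP /(_ 0 0); rewrite [RHS]mxE; apply/eqP; rewrite gt_eqF // posG.
Qed.

Lemma cap_orthC : (Qp :&: Q)%MS = 0.
Proof. by apply/eqP; rewrite -submx0 capmxC cap_orth submx0. Qed.

(** A dimension count: [G] is invertible and symmetric, so [G Q^T] has the rank of [Q] and its
    kernel has the complementary dimension. *)
Lemma add_orth (m : nat) (v : 'M[R]_(m, n)) : (v <= Q + Qp)%MS.
Proof.
apply: submx_full; rewrite /row_full eqn_leq rank_leq_col /=.
have := mxrank_sum_cap Q Qp; rewrite cap_orth mxrank0 addn0 => ->.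
have rk : \rank (G *m Q^T) = \rank Q.
  by rewrite -mxrank_tr trmx_mul trmxK symG mxrankMfree ?row_free_unit ?metric_unit.
by rewrite /Qp mxrank_ker rk subnKC // rank_leq_col.
Qed.

Lemma proj_id m (v : 'M[R]_(m, n)) : (v <= Q)%MS -> v *m P = v.
Proof. by move=> vQ; rewrite proj_mx_id ?cap_orth. Qed.

Lemma proj_orth m (v : 'M[R]_(m, n)) : (v <= Qp)%MS -> v *m P = 0.
Proof. by move=> vQ; rewrite proj_mx_0 ?cap_orth. Qed.

Lemma proj_sub m (v : 'M[R]_(m, n)) : (v *m P <= Q)%MS.
Proof. exact: proj_mx_sub. Qed.

Lemma projp_sub m (v : 'M[R]_(m, n)) : (v *m Pp <= Qp)%MS.
Proof. exact: proj_mx_sub. Qed.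

Lemma projp_0 m (v : 'M[R]_(m, n)) : (v <= Q)%MS -> v *m Pp = 0.
Proof. by move=> vQ; rewrite proj_mx_0 ?cap_orthC. Qed.

Lemma proj_add : P + Pp = 1%:M.
Proof.
by have := add_proj_mx cap_orth (add_orth 1%:M); rewrite !mul1mx.
Qed.

Lemma projpE : Pp = 1%:M - P.
Proof. by rewrite -proj_add addrC addKr. Qed.

(** Projections of covectors are transposes of projections of vectors: [Pp^T] lands in the
    annihilator of [Q] because [Pp] kills [Q], [P^T] lands in that of [Qp] because [P] kills [Qp],
    and the two add up to the identity. *)
Lemma annih_projE : proj_mx (kermx Q^T) (kermx Qp^T) = Pp^T.
Proof.
have PpQ : Pp^T *m Q^T = 0 by rewrite -trmx_mul projp_0 ?trmx0.
have PQp : P^T *m Qp^T = 0 by rewrite -trmx_mul proj_orth ?trmx0.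
have cap0 : (kermx Q^T :&: kermx Qp^T)%MS = 0.
  apply/eqP/rowV0P => v; rewrite sub_capmx => /andP[/sub_kermxP vQ /sub_kermxP vQp].
  rewrite -[v]mulmx1 -trmx1 -proj_add linearD /= mulmxDr.
  have /submxP[D1] := proj_sub 1%:M; rewrite mul1mx => E1.
  have /submxP[D2] := projp_sub 1%:M; rewrite mul1mx => E2.
  have -> : v *m P^T = 0 by rewrite E1 trmx_mul mulmxA vQ mul0mx.
  have -> : v *m Pp^T = 0 by rewrite E2 trmx_mul mulmxA vQp mul0mx.
  by rewrite addr0.
rewrite -[LHS]mul1mx -trmx1 -proj_add linearD /= mulmxDl.
rewrite (proj_mx_0 cap0) ?add0r; last exact/sub_kermxP.
by rewrite (proj_mx_id cap0) //; exact/sub_kermxP.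
Qed.

(** The right-hand side fixes the rows of [F], hence [Q], and kills [Qp]. It expresses the
    projection rationally in a frame, whereas [proj_mx] gives no control on how the projection
    varies with the point. *)
Lemma frame_proj r (F : 'M[R]_(r, n)) :
  (F :=: Q)%MS -> F *m G *m F^T \in unitmx ->
  P = G *m F^T *m invmx (F *m G *m F^T) *m F.
Proof.
move=> FQ uF; set P' := RHS.
have FP' : F *m P' = F by rewrite /P' !mulmxA mulmxV // mul1mx.
have QP' : Q *m P' = Q.
  have /submxP[D ->] : (Q <= F)%MS by rewrite FQ.
  by rewrite -mulmxA FP'.
have QpP' : Qp *m P' = 0.
  have /submxP[D FD] : (F <= Q)%MS by rewrite FQ.
  have QpF : Qp *m G *m F^T = 0.
    by rewrite FD trmx_mul mulmxA -(mulmxA Qp) mulmx_ker mul0mx.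
  by rewrite /P' !mulmxA QpF !mul0mx.
rewrite -[P']mul1mx -proj_add mulmxDl.
have /submxP[D1] := proj_sub 1%:M; rewrite mul1mx => E1.
have /submxP[D2] := projp_sub 1%:M; rewrite mul1mx => E2.
have -> : Pp *m P' = 0 by rewrite E2 -mulmxA QpP' mulmx0.
by rewrite addr0 {2}E1 -mulmxA QP' -E1.
Qed.

Lemma frame_unit r (F : 'M[R]_(r, n)) : row_free F -> F *m G *m F^T \in unitmx.
Proof.
move=> fF; rewrite -row_free_unit -kermx_eq0; apply/rowV0P => v /sub_kermxP vF.
have : v *m F = 0.
  apply: contrapT => /eqP /posG; rewrite trmx_mul !mulmxA.
  by rewrite -(mulmxA v) -(mulmxA v) vF mul0mx mxE ltxx.
by move=> /(congr1 (mulmx^~ (pinvmx F))) /=; rewrite mul0mx -mulmxA mulmxVp // mulmx1.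
Qed.

(** Turns the open condition that a Gram determinant is nonzero back into independence of the frame
    at nearby points. *)
Lemma free_of_unit r (F : 'M[R]_(r, n)) : F *m G *m F^T \in unitmx -> row_free F.
Proof.
move=> uF; apply/row_freeP; exists (G *m F^T *m invmx (F *m G *m F^T)).
by rewrite !mulmxA mulmxV.
Qed.

Lemma cometricE : invmx G *m P =
  let F := row_base Q in F^T *m invmx (F *m G *m F^T) *m F.
Proof.
rewrite /= (@frame_proj _ (row_base Q)).
- by rewrite !mulmxA mulVmx ?metric_unit // mul1mx.
- exact: eq_row_base.
- apply: frame_unit; exact: row_base_free.
Qed.

(** [invmx G *m P] is the matrix of the cometric, and its expression in a frame is visibly
    symmetric. *)
Lemma cometric_sym : (invmx G *m P)^T = invmx G *m P.
Proof.
rewrite cometricE /=; move: (\rank Q) (row_base Q) => r F.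
by rewrite !trmx_mul trmxK trmx_inv !trmx_mul trmxK symG !mulmxA.
Qed.

End OrthogonalProjection.

(** * The metric and the cometric of the distribution in a chart *)

Section Metric.
Context {R : realType} {n k : nat} {M : manifold R n} (G Q : M -> 'M[R]_n).
Hypotheses (hG : riemannian G) (hQ : regular_distribution k Q).
Implicit Types (i : idx M) (x y : M).

Lemma metric_tr y : (G y)^T = G y.
Proof.
apply/matrixP => a b; rewrite mxE.
have := Defs.metric_sym hG y (delta_mx 0 b) (delta_mx 0 a).
by rewrite /inner -!rowE !trmx_delta -!colE !mxE.
Qed.

Lemma metric_posmx y (v : 'rV[R]_n) : v != 0 -> 0 < (v *m G y *m v^T) 0 0.
Proof. exact: (Defs.metric_pos hG). Qed.

(** The metric in the chart [i]: [G y] is stored in the chart [chart_at y], which varies arbitrarily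
    with [y], and the Jacobians bring it to a fixed one. *)
Definition gram i u : 'M[R]_n :=
  let y := psi i u in Jac i (chart_at y) y *m G y *m (Jac i (chart_at y) y)^T.

(** The cometric in the chart [i]. On row vectors, multiplication by [cogram] is the bundle map [g],
    and multiplication by [gram *m cogram] is the orthogonal projection onto [Q]. *)
Definition cogram i u : 'M[R]_n :=
  let y := psi i u in
  (Jac (chart_at y) i y)^T *m (invmx (G y) *m pi_Q G Q y) *m Jac (chart_at y) i y.

Lemma gram_tr i u : (gram i u)^T = gram i u.
Proof. by rewrite /gram /= !trmx_mul trmxK metric_tr mulmxA. Qed.

Lemma cogram_tr i u : (cogram i u)^T = cogram i u.
Proof.
have := cometric_sym (Q (psi i u)) (metric_tr (psi i u)) (@metric_posmx (psi i u)).
rewrite /cogram /= /pi_Q /Qperp; move: (invmx _ *m _) => C CT.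
by rewrite !trmx_mul trmxK CT mulmxA.
Qed.

Lemma Jac_atV i y : dom i y -> Jac (chart_at y) i y *m Jac i (chart_at y) y = 1%:M.
Proof. by move=> iy; rewrite Jac_sym //; exact: dom_chart_at. Qed.

Lemma Jac_at_trV i y : dom i y ->
  (Jac i (chart_at y) y)^T *m (Jac (chart_at y) i y)^T = 1%:M.
Proof. by move=> iy; rewrite -trmx_mul Jac_atV ?trmx1. Qed.

Lemma gramE i y : dom i y ->
  gram i (phi i y) = Jac i (chart_at y) y *m G y *m (Jac i (chart_at y) y)^T.
Proof. by move=> iy; rewrite /gram /= phiK. Qed.

Lemma cogramE i y : dom i y -> cogram i (phi i y) =
  (Jac (chart_at y) i y)^T *m (invmx (G y) *m pi_Q G Q y) *m Jac (chart_at y) i y.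
Proof. by move=> iy; rewrite /cogram /= phiK. Qed.

Lemma flat_coord i y v : dom i y ->
  ccoord i y (flat G y v) = tcoord i y v *m gram i (phi i y).
Proof.
move=> iy; rewrite ccoordE tcoordE gramE // !mulmxA -(mulmxA v).
by rewrite Jac_atV // mulmx1.
Qed.

Lemma inner_coord i y v w : dom i y ->
  inner G y v w = (tcoord i y v *m gram i (phi i y) *m (tcoord i y w)^T) 0 0.
Proof.
move=> iy; rewrite !tcoordE gramE // trmx_mul !mulmxA -(mulmxA v) Jac_atV // mulmx1.
by rewrite -[v *m G y *m _ *m _]mulmxA Jac_at_trV // mulmx1.
Qed.

Lemma gmap_coord i y p : dom i y ->
  tcoord i y (gmap G Q y p) = ccoord i y p *m cogram i (phi i y).
Proof.
move=> iy; rewrite ccoordE tcoordE cogramE // /gmap /sharp; move: (pi_Q _ _ _) => P.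
rewrite !mulmxA -(mulmxA p (Jac _ _ _)^T).
by rewrite Jac_at_trV // mulmx1.
Qed.

Lemma pi_coord i y v : dom i y ->
  tcoord i y (v *m pi_Q G Q y) = tcoord i y v *m gram i (phi i y) *m cogram i (phi i y).
Proof.
move=> iy; rewrite !tcoordE cogramE // gramE //; move: (pi_Q _ _ _) => P.
rewrite !mulmxA -(mulmxA v (Jac _ _ _)) Jac_atV // mulmx1.
rewrite -[v *m G y *m _ *m _]mulmxA Jac_at_trV // mulmx1 -(mulmxA v (G y)).
by rewrite mulmxV ?mulmx1 //; apply: metric_unit; exact: metric_posmx.
Qed.

Lemma section_coord i y v : dom i y -> (v <= Q y)%MS ->
  tcoord i y v *m gram i (phi i y) *m cogram i (phi i y) = tcoord i y v.
Proof.
move=> iy vQ; rewrite -pi_coord // /pi_Q proj_id //; exact: metric_posmx.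
Qed.

Lemma tau_perpE y : tau_perp G Q y = 1%:M - (pi_Q G Q y)^T.
Proof.
rewrite /tau_perp /annih /Qperp annih_projE; [|exact: metric_tr|exact: metric_posmx].
rewrite projpE; [|exact: metric_tr|exact: metric_posmx].
by rewrite linearB /= trmx1.
Qed.

Lemma pi_perpE y : pi_perp G Q y = 1%:M - pi_Q G Q y.
Proof. by rewrite /pi_perp projpE; [|exact: metric_tr|exact: metric_posmx]. Qed.

Lemma tau_perp_coord i y p : dom i y ->
  ccoord i y (p *m tau_perp G Q y) =
  ccoord i y p - ccoord i y p *m cogram i (phi i y) *m gram i (phi i y).
Proof.
move=> iy; rewrite tau_perpE mulmxBr mulmx1 !ccoordE mulmxBl; congr (_ - _).
have /(congr1 trmx) : Jac i (chart_at y) y *m pi_Q G Q y *m Jac (chart_at y) i y =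
    gram i (phi i y) *m cogram i (phi i y).
  apply/row_matrixP => a; rewrite !rowE.
  have := pi_coord (tcoord_inv i y (delta_mx 0 a)) iy.
  rewrite (tcoord_invK _ iy) [X in X = _]tcoordE /tcoord_inv => E.
  rewrite (mulmxA _ (gram _ _)) -E.
  by move: (pi_Q _ _ _) => P; rewrite !mulmxA.
rewrite (trmx_mul (gram _ _)) gram_tr cogram_tr -(mulmxA _ (cogram _ _)) => <-.
move: (pi_Q _ _ _) => P; rewrite !trmx_mul.
by rewrite !mulmxA -(mulmxA p (Jac _ _ _)^T) Jac_at_trV // mulmx1.
Qed.

Lemma hamiltonian_inE i (z : 'rV[R]_n * 'rV[R]_n) :
  hamiltonian_in G Q i z = 2^-1 * (z.2 *m cogram i z.1 *m z.2^T) 0 0.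
Proof.
rewrite /hamiltonian_in /hamiltonian /gbar /pairing /gmap /sharp; congr (_ * _).
rewrite ccoord_invE /cogram /=; set y := psi i z.1; set S := Jac _ _ _.
have := cometric_sym (Q y) (metric_tr y) (@metric_posmx y).
rewrite /pi_Q /Qperp -(mulmxA _ (invmx (G y))); move: (invmx _ *m _) => C CT.
by rewrite !trmx_mul trmxK CT !mulmxA.
Qed.

Lemma smooth_gram i : msmooth (phi i @` dom i) (gram i).
Proof.
move=> a b.
have := metric_smooth hG (@dom_open _ _ _ i) (smooth_coord_field i (delta_mx 0 a))
  (smooth_coord_field i (delta_mx 0 b)).
move=> /(_ i); rewrite setIid; apply: smooth_on_ext; first exact: img_open.
move=> u iu /=; rewrite (inner_coord _ _ (psi_dom iu)) !tcoord_invK; try exact: psi_dom.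
by rewrite psiK // -rowE trmx_delta -colE !mxE.
Qed.

(** Sections of [Q] through a basis of [Q] at [psi i u0] have a Gram determinant that is nonzero at
    [u0], hence nearby. There they form a smooth frame of [Q], and [frame_proj] gives the cometric
    as a smooth expression in it. *)
Lemma smooth_cogram i : msmooth (phi i @` dom i) (cogram i).
Proof.
move=> a b; apply: smooth_on_local => u0 iu0.
have [rk secs] := hQ.
pose r := \rank (Q (psi i u0)).
have /choice[X XP] : forall l : 'I_r, exists X, section_of Q X /\
    X (psi i u0) = row l (row_base (Q (psi i u0))).
  move=> l; have [|X sX Xl] := secs (psi i u0) (row l (row_base (Q (psi i u0)))).
    by apply: (submx_trans (row_sub _ _)); rewrite eq_row_base.
  by exists X.
pose Fy y : 'M[R]_(r, n) := \matrix_l X l y.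
pose F u : 'M[R]_(r, n) := Fy (psi i u) *m Jac (chart_at (psi i u)) i (psi i u).
have oi : open (phi i @` dom i) by exact: img_open.
have sF : msmooth (phi i @` dom i) F.
  move=> l c; have [[/(_ i) sX _] _] := XP l.
  rewrite setTI in sX.
  have /(smooth_on_coordP _ oi) /(_ 0 c) := sX; apply: (smooth_on_ext oi) => u iu.
  have -> : F u l c = (row l (F u)) 0 c by rewrite [RHS]mxE.
  by rewrite row_mul rowK -tcoordE.
have FG u : (phi i @` dom i) u -> F u *m gram i u *m (F u)^T =
    Fy (psi i u) *m G (psi i u) *m (Fy (psi i u))^T.
  move=> iu; have du := psi_dom iu.
  rewrite /F /gram /= trmx_mul !mulmxA -(mulmxA (Fy _) (Jac _ _ _)) Jac_atV // mulmx1.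
  by rewrite -[_ *m G _ *m _ *m _]mulmxA Jac_at_trV // mulmx1.
have sFG : msmooth (phi i @` dom i) (fun u => F u *m gram i u *m (F u)^T).
  apply: (msmoothM oi); last exact: (msmooth_tr oi).
  by apply: (msmoothM oi) => //; exact: smooth_gram.
pose D u := \det (F u *m gram i u *m (F u)^T).
have sD : smooth_on (phi i @` dom i) D by exact: smooth_on_det.
have Du0 : D u0 != 0.
  rewrite /D -unitfE -unitmxE FG //; apply: frame_unit; first exact: metric_posmx.
  have -> : Fy (psi i u0) = row_base (Q (psi i u0)).
    by apply/row_matrixP => l; rewrite rowK; have [_ ->] := XP l.
  exact: row_base_free.
pose B := ((phi i @` dom i) `&` (D @^-1` [set d | d != 0]))°.
have Bu0 : B u0.
  apply: filterI; first by apply: open_nbhs_nbhs.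
  apply: (smooth_on_continuous sD iu0); apply: open_nbhs_nbhs.
  by split; [exact: open_neq|exact: Du0].
have oB : open B by exact: open_interior.
have Bi : B `<=` phi i @` dom i by move=> u /interior_subset [].
have BD u : B u -> D u != 0 by move=> /interior_subset [].
exists B => //.
apply: (@smooth_on_ext _ _ _ _
  (fun u => ((F u)^T *m invmx (F u *m gram i u *m (F u)^T) *m F u) a b)) => //; last first.
  have sFB : msmooth B F by move=> l c; apply: smooth_on_sub (sF l c).
  apply: (msmoothM oB) => //; apply: (msmoothM oB); first exact: (msmooth_tr oB).
  apply: msmooth_inv => //; first by move=> u /BD; rewrite unitmxE unitfE.
  by move=> l c; apply: smooth_on_sub (sFG l c).
move=> u Bu; congr (fun_of_matrix _ a b); have iu := Bi _ Bu.
have uF : Fy (psi i u) *m G (psi i u) *m (Fy (psi i u))^T \in unitmx.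
  by rewrite -FG // unitmxE unitfE; exact: BD.
(* Regularity enters here: [r] independent vectors of [Q] span it because its rank is [r] at every
   point. *)
have FQ : (Fy (psi i u) :=: Q (psi i u))%MS.
  apply/eqmxP; rewrite -(geq_leqif (mxrank_leqif_eq _)).
    by rewrite (eqP (free_of_unit uF)) /r !rk.
  by apply/row_subP => l; rewrite rowK; have [[_ ->]] := XP l.
rewrite FG // /cogram /=.
have -> : pi_Q G Q (psi i u) = _ := frame_proj (metric_tr _) (@metric_posmx _) FQ uF.
rewrite -!(mulmxA (G _)) (mulmxA (invmx _)) mulVmx ?mul1mx; last by apply: metric_unit; exact: metric_posmx.
by rewrite /F trmx_mul !mulmxA.
Qed.

Lemma cogram_section i y (p : 'rV[R]_n) : dom i y ->
  (tcoord_inv i y (p *m cogram i (phi i y)) <= Q y)%MS.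
Proof.
move=> iy; rewrite cogramE // /tcoord_inv.
have : forall w : 'rV_n, (w *m (invmx (G y) *m pi_Q G Q y) <= Q y)%MS.
  by move=> w; rewrite mulmxA; exact: proj_sub.
move: (invmx _ *m _) => C CQ.
by rewrite -!mulmxA Jac_atV // mulmx1 mulmxA.
Qed.

Lemma cogram_idem i u : (phi i @` dom i) u ->
  cogram i u *m gram i u *m cogram i u = cogram i u.
Proof.
move=> iu; have du := psi_dom iu; rewrite -(psiK iu); apply/row_matrixP => a.
have := section_coord du (cogram_section (delta_mx 0 a) du).
by rewrite tcoord_invK // !rowE !mulmxA.
Qed.

End Metric.

(** * Derivatives of matrix products, and one-sided derivatives *)

Section MatrixDerivatives.
Context {R : realType} {V : normedModType R}.

Lemma is_derive_mxP m n (F : V -> 'M[R]_(m, n)) x v dF :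
  is_derive x v F dF <-> forall i j, is_derive x v (fun y => F y i j) (dF i j).
Proof.
split=> [[d <-] i j|H].
  split; first by move/derivable_mxP: d; exact.
  by rewrite derive_mx // mxE.
have d : derivable F x v by apply/derivable_mxP => i j; have [] := H i j.
split => //; apply/matrixP => i j; rewrite derive_mx // mxE.
by have [] := H i j.
Qed.

Lemma is_derive_suml m (f : 'I_m -> V -> R) x v (df : 'I_m -> R) :
  (forall l, is_derive x v (f l) (df l)) ->
  is_derive x v (fun y => \sum_l f l y) (\sum_l df l).
Proof.
move=> H; have := @is_derive_sum _ _ _ _ f x v df H.
by rewrite (_ : (fun y => \sum_l f l y) = \sum_l f l) //; apply/funext => y; rewrite fct_sumE.
Qed.

Lemma is_derive_mulr (f g : V -> R) x v (df dg : R) :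
  is_derive x v f df -> is_derive x v g dg ->
  is_derive x v (fun y => f y * g y) (df * g x + f x * dg).
Proof.
move=> Hf Hg; apply: is_derive_eq (is_deriveM Hf Hg) _.
by rewrite addrC; congr (_ + _); rewrite mulrC.
Qed.

Lemma is_derive_mulmx m n p (F : V -> 'M[R]_(m, n)) (H : V -> 'M[R]_(n, p)) x v dF dH :
  is_derive x v F dF -> is_derive x v H dH ->
  is_derive x v (fun y => F y *m H y) (dF *m H x + F x *m dH).
Proof.
move=> /is_derive_mxP HF /is_derive_mxP HH; apply/is_derive_mxP => i j.
rewrite (_ : (fun y => _) = (fun y => \sum_l F y i l * H y l j)); last first.
  by apply/funext => y; rewrite mxE.
rewrite !mxE -big_split /=; apply: is_derive_suml => l.
exact: is_derive_mulr.
Qed.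

Lemma is_derive_trmx m n (F : V -> 'M[R]_(m, n)) x v dF :
  is_derive x v F dF -> is_derive x v (fun y => (F y)^T) dF^T.
Proof.
move=> /is_derive_mxP HF; apply/is_derive_mxP => i j.
rewrite (_ : (fun y => _) = (fun y => F y j i)); last first.
  by apply/funext => y; rewrite mxE.
by rewrite mxE.
Qed.

Lemma is_derive_pairing n (F H : V -> 'rV[R]_n) x v dF dH :
  is_derive x v F dF -> is_derive x v H dH ->
  is_derive x v (fun y => (F y *m (H y)^T) 0 0)
    ((dF *m (H x)^T) 0 0 + (F x *m dH^T) 0 0).
Proof.
move=> HF HH.
have /is_derive_mxP /(_ 0 0) := is_derive_mulmx HF (is_derive_trmx HH).
by rewrite mxE.
Qed.

Lemma is_derive_near (W : normedModType R) (f g : V -> W) x v (df : W) :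
  (\forall y \near x, f y = g y) -> is_derive x v f df -> is_derive x v g df.
Proof. exact: near_eq_is_derive. Qed.

End MatrixDerivatives.

Section OneSided.
Context {R : realType}.

(** At an endpoint [f] is known to vanish on one side only. As the two-sided derivative exists, it
    equals either one-sided limit of the difference quotient, and [a < b] leaves room on the right
    if [t < b] and on the left if [t = b]. *)
Lemma derive_eq0_on_segment (a b t : R) (f : R -> R) : a < b -> a <= t <= b ->
  (\forall r \near t, a <= r <= b -> f r = 0) -> derivable f t 1 -> 'D_1 f t = 0.
Proof.
move=> ab /andP[at_ tb] f0 /cvg_ex[l /= fl].
have ft : f t = 0 by apply: (nbhs_singleton f0); rewrite at_ tb.
have -> : 'D_1 f t = l by exact/cvg_lim.
have near0 : \forall h \near (0 : R), a <= h + t <= b -> f (h + t) = 0.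
  have ct : (fun h : R => h + t) @ (0 : R) --> t.
    rewrite -[X in _ --> X]add0r.
    by apply: (@cvgD _ _ _ (nbhs (0 : R)) _ (fun h => h) (fun=> t)); [exact: cvg_id|exact: cvg_cst].
  exact: (ct _ f0).
have {}fl : (fun h : R => h^-1 * f (h + t)) @ 0^' --> l.
  have E : (fun h : R => h^-1 *: (f (h *: 1 + t) - f t)) = (fun h : R => h^-1 * f (h + t)).
    by apply/funext => h; rewrite ft subr0 [h%:A]mulr1.
  by rewrite -E.
have [tb'|bt] := ltP t b.
  have fr := cvg_dnbhs_at_right fl.
  have : (fun h : R => h^-1 * f (h + t)) @ 0^'+ --> (0 : R).
    apply: cvg_near_cst; near=> h.
    have h0 : 0 < h by near: h; exact: nbhs_right_gt.
    have hb : h <= b - t by near: h; apply: nbhs_right_le; rewrite subr_gt0.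
    suff -> : f (h + t) = 0 by rewrite mulr0.
    have : a <= h + t <= b -> f (h + t) = 0.
      by near: h; apply: cvg_within; exact: near0.
    by apply; apply/andP; split; lra.
  by move/(cvg_unique _ fr) => ->.
have at' : a < t by lra.
have fr := cvg_dnbhs_at_left fl.
have : (fun h : R => h^-1 * f (h + t)) @ 0^'- --> (0 : R).
  apply: cvg_near_cst; near=> h.
  have h0 : h < 0 by near: h; exact: nbhs_left_lt.
  have hb : a - t <= h by near: h; apply: nbhs_left_ge; rewrite subr_lt0.
  suff -> : f (h + t) = 0 by rewrite mulr0.
  have : a <= h + t <= b -> f (h + t) = 0.
    by near: h; apply: cvg_within; exact: near0.
  by apply; apply/andP; split; lra.
by move/(cvg_unique _ fr) => ->.
Unshelve. all: by end_near. Qed.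

Lemma derive_eq_on_segment (a b t : R) (f g : R -> R) : a < b -> a <= t <= b ->
  (\forall r \near t, a <= r <= b -> f r = g r) ->
  derivable f t 1 -> derivable g t 1 -> 'D_1 f t = 'D_1 g t.
Proof.
move=> ab tab fg df dg; apply/eqP; rewrite -subr_eq0; apply/eqP.
rewrite -deriveB //; apply: (derive_eq0_on_segment ab tab); last exact: derivableB.
by apply: filterS fg => r H /H fr; rewrite /GRing.add/= /GRing.opp /= fr subrr.
Qed.

End OneSided.

(** * Derivatives along curves *)

Section AtPoint.
Context {R : realType} {n : nat} {M : manifold R n}.
Implicit Types (U : set M) (x : M) (p w : 'rV[R]_n).

Local Notation ch x := (chart_at x).
Local Notation at_ x := (phi (chart_at x) x).

Lemma chart_point x : dom (ch x) x. Proof. exact: dom_chart_at. Qed.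

Lemma psi_at x : psi (ch x) (at_ x) = x.
Proof. by rewrite phiK //; exact: chart_point. Qed.

Lemma field_in_at x (X : M -> 'rV[R]_n) : field_in (ch x) X (at_ x) = X x.
Proof. by rewrite /field_in psi_at tcoord_at. Qed.

Lemma form_in_at x (e : M -> 'rV[R]_n) : form_in (ch x) e (at_ x) = e x.
Proof. by rewrite /form_in psi_at ccoord_at. Qed.

Lemma near_at x U : open U -> U x ->
  \forall u \near at_ x, (phi (ch x) @` dom (ch x)) u /\ U (psi (ch x) u).
Proof.
move=> oU Ux; have := near_chart_image (chart_point x) oU Ux.
by apply: filterS => u /chart_imageE.
Qed.

Lemma field_differentiable U x X : open U -> U x -> smooth_field U X ->
  differentiable (field_in (ch x) X) (at_ x).
Proof.
move=> oU Ux /(_ (ch x)) sX; apply: smooth_on_differentiable sX _.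
  exact: open_chart_image.
by exists x => //; split => //; exact: chart_point.
Qed.

Lemma form_differentiable U x e : open U -> U x -> smooth_form U e ->
  differentiable (form_in (ch x) e) (at_ x).
Proof.
move=> oU Ux /(_ (ch x)) sX; apply: smooth_on_differentiable sX _.
  exact: open_chart_image.
by exists x => //; split => //; exact: chart_point.
Qed.

Lemma fun_differentiable U x f : open U -> U x -> smooth_fun U f ->
  differentiable (f \o psi (ch x)) (at_ x).
Proof.
move=> oU Ux /(_ (ch x)) sX; apply: C1_differentiable (sX 1%N).
  exact: open_chart_image.
by exists x => //; split => //; exact: chart_point.
Qed.

Lemma is_derive_diff (V W : normedModType R) (f : V -> W) (x v : V) : differentiable f x ->
  @is_derive R V W x v f ('D_v f x).
Proof. by move=> d; split => //; exact: diff_derivable. Qed.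

Lemma pairing_in_chart x (e X : M -> 'rV[R]_n) :
  \forall u \near at_ x,
    (form_in (ch x) e u *m (field_in (ch x) X u)^T) 0 0 =
    pairing (e (psi (ch x) u)) (X (psi (ch x) u)).
Proof.
have := near_dom (chart_point x).
apply: filterS => u iu; rewrite /form_in /field_in.
exact: (pairing_coord _ _ (psi_dom iu)).
Qed.

(** Obtained by differentiating [e (X) = 0]. It lets a derivative of the form be traded for one of
    the field inside [dform]. *)
Lemma annihilating_form_derive U x (e X : M -> 'rV[R]_n) w : open U -> U x ->
  smooth_form U e -> smooth_field U X -> (forall y, U y -> pairing (e y) (X y) = 0) ->
  pairing ('D_w (form_in (ch x) e) (at_ x)) (X x) +
  pairing (e x) ('D_w (field_in (ch x) X) (at_ x)) = 0.
Proof.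
move=> oU Ux se sX eX.
have de := is_derive_diff w (form_differentiable oU Ux se).
have dX := is_derive_diff w (field_differentiable oU Ux sX).
have [_] := is_derive_pairing de dX; rewrite form_in_at field_in_at => <-.
rewrite (@near_eq_derive _ _ _ _ (fun=> 0)) ?derive_cst //.
near=> u.
have [iu Uu] : (phi (ch x) @` dom (ch x)) u /\ U (psi (ch x) u).
  by near: u; exact: near_at.
rewrite -(eX _ Uu); near: u; exact: pairing_in_chart.
Unshelve. all: by end_near. Qed.

Section Curve.
Context (A : set R) (c : R -> M).
Hypotheses (oA : open A) (smc : smooth_map A c).

Lemma open_preimage U : open U -> open (A `&` c @^-1` U).
Proof.
move=> oU; rewrite openE => t [At Uct]; apply: filterI; first exact: open_nbhs_nbhs.
by apply: smc.1 => //; exact: open_nbhs_nbhs.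
Qed.

Lemma near_curve t U : A t -> open U -> U (c t) -> \forall r \near t, A r /\ U (c r).
Proof.
by move=> At oU Uct; apply: open_nbhs_nbhs; split; [exact: open_preimage|].
Qed.

Lemma curve_derivable i t : A t -> dom i (c t) -> derivable (phi i \o c) t 1.
Proof. by move=> At it; apply: smooth_on_derivable (smc.2 i) _. Qed.

Lemma vel_at t : vel c t = 'D_1 (phi (ch (c t)) \o c) t.
Proof. by rewrite /vel derive1E. Qed.

Lemma vel_coord i t : A t -> dom i (c t) ->
  tcoord i (c t) (vel c t) = 'D_1 (phi i \o c) t.
Proof.
move=> At it; rewrite tcoordE (mul_Jac _ (chart_point _) it) vel_at.
have dq := curve_derivable At (chart_point (c t)).
have df := transition_differentiable (chart_point (c t)) it.
have [_ <-] := is_derive_compose dq df.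
apply: near_eq_derive.
have := near_curve At (@dom_open _ _ M (ch (c t))) (chart_point _).
by apply: filterS => r [_ ir] /=; rewrite phiK.
Qed.

Lemma is_derive_curve (W : normedModType R) t (f : 'rV[R]_n -> W) : A t ->
  differentiable f (at_ (c t)) ->
  is_derive t 1 (fun r => f (phi (ch (c t)) (c r))) ('D_(vel c t) f (at_ (c t))).
Proof.
move=> At df; rewrite vel_at.
exact: (is_derive_compose (curve_derivable At (chart_point (c t))) df).
Qed.

Lemma is_derive_fun t U f : A t -> open U -> U (c t) -> smooth_fun U f ->
  is_derive t 1 (fun r => f (c r)) (dfun f (c t) (vel c t)).
Proof.
move=> At oU Uct sf.
apply: is_derive_near (is_derive_curve At (fun_differentiable oU Uct sf)).
have := near_curve At (@dom_open _ _ M (ch (c t))) (chart_point _).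
by apply: filterS => r [_ ir] /=; rewrite phiK.
Qed.

(** The product rule in the chart around [c t], kept fixed while [r] varies; the pairing does not
    depend on the chart. *)
Lemma is_derive_pairing_curve t U (alpha : R -> 'rV[R]_n) dp (Z : M -> 'rV[R]_n) :
  A t -> open U -> U (c t) -> smooth_field U Z ->
  is_derive t 1 (fun r => ccoord (ch (c t)) (c r) (alpha r)) dp ->
  is_derive t 1 (fun r => pairing (alpha r) (Z (c r)))
    (pairing dp (Z (c t)) +
     pairing (alpha t) ('D_(vel c t) (field_in (ch (c t)) Z) (at_ (c t)))).
Proof.
move=> At oU Uct sZ Hp.
have HZ := is_derive_curve At (field_differentiable oU Uct sZ).
have := is_derive_pairing Hp HZ.
rewrite field_in_at ccoord_at; apply: is_derive_near.
have := near_curve At (@dom_open _ _ M (ch (c t))) (chart_point _).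
apply: filterS => r [_ ir] /=; rewrite /field_in phiK //.
exact: (pairing_coord _ _ ir).
Qed.

Lemma is_derive_form_curve t U (e Z : M -> 'rV[R]_n) :
  A t -> open U -> U (c t) -> smooth_form U e -> smooth_field U Z ->
  is_derive t 1 (fun r => pairing (e (c r)) (Z (c r)))
    (pairing ('D_(vel c t) (form_in (ch (c t)) e) (at_ (c t))) (Z (c t)) +
     pairing (e (c t)) ('D_(vel c t) (field_in (ch (c t)) Z) (at_ (c t)))).
Proof.
move=> At oU Uct se sZ.
apply: (is_derive_pairing_curve (alpha := fun r => e (c r)) At oU Uct sZ).
apply: is_derive_near (is_derive_curve At (form_differentiable oU Uct se)).
have := near_curve At (@dom_open _ _ M (ch (c t))) (chart_point _).
by apply: filterS => r [_ ir] /=; rewrite /form_in phiK.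
Qed.

End Curve.
End AtPoint.

(** * Hamilton's equations *)

Section Bilinear.
Context {R : realType} {n : nat}.
Implicit Types (p v w : 'rV[R]_n).

Lemma pairingDl p p' v : pairing (p + p') v = pairing p v + pairing p' v.
Proof. by rewrite /pairing mulmxDl mxE. Qed.

Lemma pairingDr p v w : pairing p (v + w) = pairing p v + pairing p w.
Proof. by rewrite /pairing linearD mulmxDr mxE. Qed.

Lemma pairingZl (r : R) p v : pairing (r *: p) v = r * pairing p v.
Proof. by rewrite /pairing -scalemxAl mxE. Qed.

Lemma pairingNl p v : pairing (- p) v = - pairing p v.
Proof. by rewrite -scaleN1r pairingZl mulN1r. Qed.

Lemma pairingBl p p' v : pairing (p - p') v = pairing p v - pairing p' v.
Proof. by rewrite pairingDl pairingNl. Qed.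

Lemma pairing0l v : pairing 0 v = 0 :> R.
Proof. by rewrite /pairing mul0mx mxE. Qed.

Lemma pairing0r p : pairing p 0 = 0 :> R.
Proof. by rewrite /pairing trmx0 mulmx0 mxE. Qed.

Lemma pairingC p v : pairing p v = pairing v p.
Proof.
by rewrite /pairing -[in LHS](trmxK (p *m _)) trmx_mul trmxK [LHS]mxE.
Qed.

Lemma pairing_suml m (f : 'I_m -> 'rV[R]_n) v :
  pairing (\sum_l f l) v = \sum_l pairing (f l) v.
Proof. by rewrite /pairing mulmx_suml summxE. Qed.

Lemma pairingZr (r : R) p v : pairing p (r *: v) = r * pairing p v.
Proof. by rewrite pairingC pairingZl pairingC. Qed.

Lemma pairingBr p v w : pairing p (v - w) = pairing p v - pairing p w.
Proof. by rewrite !(pairingC p) pairingBl. Qed.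

Lemma pairing_sumr m p (f : 'I_m -> 'rV[R]_n) :
  pairing p (\sum_l f l) = \sum_l pairing p (f l).
Proof. by rewrite pairingC pairing_suml; apply: eq_bigr => l _; rewrite pairingC. Qed.

Lemma pairing_mulmx p (B : 'M[R]_n) v : pairing (p *m B) v = pairing p (v *m B^T).
Proof. by rewrite /pairing trmx_mul trmxK mulmxA. Qed.

Lemma pairing_eq0 p : (forall v, pairing p v = 0) -> p = 0.
Proof.
move=> H; apply/rowP => l; rewrite [RHS]mxE -[RHS](H (delta_mx 0 l)).
by rewrite /pairing trmx_delta -colE mxE.
Qed.

Lemma pairing_delta p l : pairing p (delta_mx 0 l) = p 0 l.
Proof. by rewrite /pairing trmx_delta -colE mxE. Qed.

End Bilinear.

Lemma is_derive_scal (R : realType) (V : normedModType R) (r : R) (f : V -> R) x v df :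
  is_derive x v f df -> is_derive x v (fun y => r * f y) (r * df).
Proof. by move=> H; exact: is_deriveZ. Qed.

Section Identities.
Context {R : realType} {n k : nat} {M : manifold R n} (G Q : M -> 'M[R]_n).
Hypotheses (hG : riemannian G) (hQ : regular_distribution k Q).
Implicit Types (U : set M) (x : M) (p v w : 'rV[R]_n).

Local Notation ch x := (chart_at x).
Local Notation at_ x := (phi (chart_at x) x).

Lemma innerE x v w : inner G x v w = pairing (flat G x v) w.
Proof. by []. Qed.

Lemma innerC x v w : inner G x v w = inner G x w v.
Proof. exact: Defs.metric_sym. Qed.

Lemma gmap_at x p : gmap G Q x p = p *m cogram G Q (ch x) (at_ x).
Proof.
have := gmap_coord G Q p (chart_point x).
by rewrite tcoord_at ccoord_at.
Qed.

Lemma is_derive_msmooth m1 m2 (A : set 'rV[R]_n) (F : 'rV[R]_n -> 'M[R]_(m1, m2)) u w :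
  msmooth A F -> A u -> is_derive u w F ('D_w F u).
Proof.
move=> sF Au; split => //; apply/derivable_mxP => a b.
exact: smooth_on_derivable (sF a b) Au.
Qed.

Lemma dfun_inner x (Y Z : M -> 'rV[R]_n) w : 
  dfun (fun y => inner G y (Y y) (Z y)) x w =
  'D_w (fun u => (field_in (ch x) Y u *m gram G (ch x) u *m (field_in (ch x) Z u)^T) 0 0)
     (at_ x).
Proof.
rewrite /dfun; apply: near_eq_derive.
have := near_dom (chart_point x); apply: filterS => u iu /=.
by rewrite (inner_coord G _ _ (psi_dom iu)) psiK.
Qed.

(* Hamilton's second equation [dp = - dH/dq] at [(x, p)], with both sides in
   one member and evaluated on [w]. *)
Definition hamilton_defect x p (dp w : 'rV[R]_n) : R :=
  pairing dp w + 2^-1 * 'D_w (fun u => (p *m cogram G Q (ch x) u *m p^T) 0 0) (at_ x).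

Lemma is_derive_cogram_form x p w :
  is_derive (at_ x) w (fun u => (p *m cogram G Q (ch x) u *m p^T) 0 0)
    ((p *m 'D_w (cogram G Q (ch x)) (at_ x) *m p^T) 0 0).
Proof.
have ix : (phi (ch x) @` dom (ch x)) (at_ x) by exists x => //; exact: chart_point.
have HB := is_derive_msmooth w (smooth_cogram hG hQ (ch x)) ix.
have Hp := @is_derive_cst _ _ _ p (at_ x) w.
have Hpt := @is_derive_cst _ _ _ (p^T) (at_ x) w.
have /is_derive_mxP /(_ 0 0) := is_derive_mulmx (is_derive_mulmx Hp HB) Hpt.
by rewrite mul0mx add0r mulmx0 addr0.
Qed.

(** Full differentiability, not just directional derivatives, makes the Hamilton defect additive in
    the test vector. *)
Lemma cogram_form_differentiable x p :
  differentiable (fun u => (p *m cogram G Q (ch x) u *m p^T) 0 0) (at_ x).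
Proof.
have oi : open (phi (ch x) @` dom (ch x)) by exact: img_open.
have ix : (phi (ch x) @` dom (ch x)) (at_ x) by exists x => //; exact: chart_point.
have sp : msmooth (phi (ch x) @` dom (ch x))
    (fun u => p *m cogram G Q (ch x) u *m p^T).
  apply: (msmoothM oi); last exact: msmooth_cst.
  apply: (msmoothM oi); [exact: msmooth_cst|exact: smooth_cogram hG hQ _].
exact: (C1_differentiable oi ix (sp 0 0 1%N)).
Qed.

Lemma hamilton_defectD x p dp w w' : hamilton_defect x p dp (w + w') = hamilton_defect x p dp w + hamilton_defect x p dp w'.
Proof.
rewrite /hamilton_defect !(deriveE _ (cogram_form_differentiable x p)) linearD pairingDr /=.
by rewrite mulrDr addrACA.
Qed.

Lemma section_smooth (X : M -> 'rV[R]_n) U : section_of Q X -> smooth_field U X.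
Proof. by move=> [sX _]; apply: smooth_field_sub sX. Qed.

Lemma section_differentiable (X : M -> 'rV[R]_n) x : section_of Q X ->
  differentiable (field_in (ch x) X) (at_ x).
Proof. by move=> [sX _]; apply: (@field_differentiable _ _ _ setT) => //; exact: openT. Qed.

(* With [Y = p B - X], where [B] is the cometric of [Q], the left-hand side
   minus the right-hand side is the derivative of [Y G Y^T / 2], which vanishes
   because [Y] does at [x]. *)
Lemma cogram_envelope x (X : M -> 'rV[R]_n) p w : section_of Q X ->
  gmap G Q x p = X x ->
  2^-1 * 'D_w (fun u => (p *m cogram G Q (ch x) u *m p^T) 0 0) (at_ x) =
  pairing p ('D_w (field_in (ch x) X) (at_ x))
  - 2^-1 * dfun (fun y => inner G y (X y) (X y)) x w.
Proof.
move=> secX gX; rewrite dfun_inner.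
have ix : (phi (ch x) @` dom (ch x)) (at_ x) by exists x => //; exact: chart_point.
set B := cogram G Q (ch x); set g := gram G (ch x); set Xi := field_in (ch x) X.
have HB : is_derive (at_ x) w B ('D_w B (at_ x)).
  exact: is_derive_msmooth (smooth_cogram hG hQ (ch x)) ix.
have Hg : is_derive (at_ x) w g ('D_w g (at_ x)).
  exact: is_derive_msmooth (smooth_gram hG (ch x)) ix.
have HX : is_derive (at_ x) w Xi ('D_w Xi (at_ x)).
  exact: is_derive_diff (section_differentiable x secX).
have Hp := @is_derive_cst _ _ _ p (at_ x) w.
pose Y u := p *m B u - Xi u.
have HY : is_derive (at_ x) w Y (p *m 'D_w B (at_ x) - 'D_w Xi (at_ x)).
  have := is_deriveB (is_derive_mulmx Hp HB) HX.
  by rewrite mul0mx add0r.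
have Y0 : Y (at_ x) = 0 by rewrite /Y /Xi field_in_at -gX gmap_at subrr.
have /is_derive_mxP /(_ 0 0) HYY := is_derive_mulmx (is_derive_mulmx HY Hg) (is_derive_trmx HY).
rewrite Y0 !mul0mx trmx0 mulmx0 addr0 in HYY.
have [dXX _] : is_derive (at_ x) w (fun u => (Xi u *m g u *m (Xi u)^T) 0 0)
    ('D_w (fun u => (Xi u *m g u *m (Xi u)^T) 0 0) (at_ x)).
  have /is_derive_mxP /(_ 0 0) [d _] := is_derive_mulmx (is_derive_mulmx HX Hg) (is_derive_trmx HX).
  by split.
have [dB _] := is_derive_cogram_form x p w.
have HpX := is_derive_pairing Hp HX.
rewrite mul0mx [X in X + _]mxE add0r in HpX.
(* Expanding [Y g Y^T] with [B g B = B] and [X g B = X], the latter because [X] lies in [Q], gives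
   [p B p^T - 2 p X^T + X g X^T]. *)
have key : \forall u \near at_ x,
   (p *m (Xi u)^T) 0 0 = 2^-1 * (p *m B u *m p^T) 0 0 + 2^-1 * (Xi u *m g u *m (Xi u)^T) 0 0
   - 2^-1 * (Y u *m g u *m (Y u)^T) 0 0.
  have := near_dom (chart_point x); apply: filterS => u iu.
  have Xs : Xi u *m g u *m B u = Xi u.
    have := section_coord hG (psi_dom iu) (secX.2 (psi (ch x) u)).
    by rewrite psiK.
  have Bi : B u *m g u *m B u = B u by exact: cogram_idem.
  have Bt : (B u)^T = B u by exact: cogram_tr.
  have gt : (g u)^T = g u by exact: gram_tr.
  have e1 : (Xi u *m g u *m (p *m B u)^T) 0 0 = (p *m (Xi u)^T) 0 0.
    by rewrite trmx_mul Bt mulmxA Xs -/(pairing (Xi u) p) pairingC.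
  have e2 : (p *m B u *m g u *m (Xi u)^T) 0 0 = (p *m (Xi u)^T) 0 0.
    rewrite -e1 -[LHS]/(pairing (p *m B u *m g u) (Xi u)).
    by rewrite pairing_mulmx gt pairingC.
  have e3 : (p *m B u *m g u *m (p *m B u)^T) 0 0 = (p *m B u *m p^T) 0 0.
    have pB : p *m B u *m g u *m B u = p *m B u by rewrite -2!mulmxA (mulmxA (B u)) Bi.
    by rewrite trmx_mul Bt mulmxA pB.
  rewrite -[(Y u *m g u *m _) 0 0]/(pairing (Y u *m g u) (Y u)) /Y mulmxBl pairingBl.
  rewrite !pairingBr /pairing e1 e2 e3.
  by field.
have dXX' := DeriveDef dXX erefl.
have dB' := DeriveDef dB erefl.
have HR := is_deriveB (is_deriveD (is_derive_scal 2^-1 dB') (is_derive_scal 2^-1 dXX'))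
  (is_derive_scal 2^-1 HYY).
have [_] := is_derive_near (filterS (fun u e => esym e) key) HR.
have [_ ->] := HpX.
rewrite [X in _ - 2^-1 * X]mxE mulr0 subr0 => E; apply/eqP; rewrite eq_sym subr_eq eq_sym -E.
by [].
Qed.

End Identities.

Section ProductDerivatives.
Context {R : realType}.

Lemma is_derive_fst (V1 V2 W : normedModType R) (f : V1 -> W) (x : V1) (y : V2)
    (v : V1) (w : V2) df :
  is_derive x v f df -> is_derive (x, y) (v, w) (fun z => f z.1) df.
Proof. by move=> [d e]; split. Qed.

Lemma is_derive_snd (V1 V2 W : normedModType R) (f : V2 -> W) (x : V1) (y : V2)
    (v : V1) (w : V2) df :
  is_derive y w f df -> is_derive (x, y) (v, w) (fun z => f z.2) df.
Proof. by move=> [d e]; split. Qed.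

End ProductDerivatives.

Section HamiltonEquations.
Context {R : realType} {n k : nat} {M : manifold R n} (G Q : M -> 'M[R]_n).
Hypotheses (hG : riemannian G) (hQ : regular_distribution k Q).
Implicit Types (U : set M) (x : M) (p v w : 'rV[R]_n).

Local Notation ch x := (chart_at x).
Local Notation at_ x := (phi (chart_at x) x).

Lemma derive_hamiltonian x p w r :
  'D_(w, r) (hamiltonian_in G Q (ch x)) (at_ x, p) =
  2^-1 * 'D_w (fun u => (p *m cogram G Q (ch x) u *m p^T) 0 0) (at_ x)
  + pairing r (gmap G Q x p).
Proof.
have -> : hamiltonian_in G Q (ch x) = (fun z => 2^-1 * (z.2 *m cogram G Q (ch x) z.1 *m z.2^T) 0 0).
  by apply/funext => z; exact: hamiltonian_inE.
have ix : (phi (ch x) @` dom (ch x)) (at_ x) by exists x => //; exact: chart_point.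
set B := cogram G Q (ch x).
have HB : is_derive (at_ x) w B ('D_w B (at_ x)).
  exact: is_derive_msmooth (smooth_cogram hG hQ (ch x)) ix.
have H1 := is_derive_fst p r HB.
have H2 : is_derive (at_ x, p) (w, r) (fun z : 'rV[R]_n * 'rV[R]_n => z.2) r.
  exact: (is_derive_snd (at_ x) w (is_derive_id p r)).
have H3 := is_derive_mulmx (is_derive_mulmx H2 H1) (is_derive_trmx H2).
have /is_derive_mxP /(_ 0 0) H4 := H3.
have [_ ->] := is_derive_scal 2^-1 H4.
have [_ ->] := is_derive_cogram_form hG hQ x p w.
have addE (C D : 'M[R]_1) : (C + D) 0 0 = C 0 0 + D 0 0 by rewrite mxE.
rewrite /= gmap_at -/B mulmxDl !addE.
have Bt : (B (at_ x))^T = B (at_ x) by exact: cogram_tr.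
have e1 : (r *m B (at_ x) *m p^T) 0 0 = pairing r (p *m B (at_ x)).
  by have := pairing_mulmx r (B (at_ x)) p; rewrite Bt.
have e2 : (p *m B (at_ x) *m r^T) 0 0 = pairing r (p *m B (at_ x)).
  exact: pairingC.
by rewrite e1 e2; field.
Qed.

(** Vertical test vectors [(0, r)] in the symplectic equation isolate the velocity, horizontal ones
    [(w, 0)] isolate the derivative of the momentum. *)
Lemma hamilton_iff x p dq dp :
  hamiltonian_vector (hamiltonian_in G Q (ch x)) (at_ x, p) (dq, dp) <->
  dq = gmap G Q x p /\ forall w, hamilton_defect G Q x p dp w = 0.
Proof.
split.
  move=> H; split.
    apply/eqP; rewrite -subr_eq0; apply/eqP/pairing_eq0 => r.
    have := H (0, r); rewrite derive_hamiltonian /omega /= derive0 mulr0 add0r pairing0r subr0.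
    by rewrite pairingBl (pairingC dq) (pairingC (gmap _ _ _ _)) => ->; rewrite subrr.
  move=> w; have := H (w, 0).
  rewrite derive_hamiltonian /omega /= !pairing0l sub0r addr0 /hamilton_defect => <-.
  by rewrite subrr.
move=> [-> E] [w r]; rewrite derive_hamiltonian /omega /=.
have := E w; rewrite /hamilton_defect => /eqP; rewrite addr_eq0 => /eqP ->.
by rewrite opprK addrC.
Qed.

End HamiltonEquations.

(** * Hamilton's equations in terms of the Levi-Civita connection *)

Section Connection.
Context {R : realType} {n k : nat} {M : manifold R n} (G Q : M -> 'M[R]_n).
Hypotheses (hG : riemannian G) (hQ : regular_distribution k Q).
Context (nabla : M -> 'rV[R]_n -> (M -> 'rV[R]_n) -> 'rV[R]_n).
Hypothesis hnabla : levi_civita G nabla.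
Implicit Types (U : set M) (x : M) (p v w : 'rV[R]_n).

Local Notation ch x := (chart_at x).
Local Notation at_ x := (phi (chart_at x) x).

(** A fragment of the Koszul formula: torsion-freeness exchanges [nabla_X Z] for [nabla_Z X] plus
    the bracket, and metric compatibility turns [G (X, nabla_Z X)] into half the derivative of
    [G (X, X)]. *)
Lemma nabla_koszul U x (X Z : M -> 'rV[R]_n) : open U -> U x ->
  smooth_field U X -> smooth_field U Z ->
  inner G x (X x) (nabla x (X x) Z) =
  inner G x (X x) (bracket X Z x) +
  2^-1 * dfun (fun y => inner G y (X y) (X y)) x (Z x).
Proof.
move=> oU Ux sX sZ.
rewrite (nabla_metric hnabla oU sX sX Ux) -(nabla_torsion_free hnabla oU sX sZ Ux).
rewrite (innerC hG _ (nabla _ _ _)) !innerE pairingBr.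
by field.
Qed.

Lemma bracketE x (X Z : M -> 'rV[R]_n) : bracket X Z x =
  'D_(X x) (field_in (ch x) Z) (at_ x) - 'D_(Z x) (field_in (ch x) X) (at_ x).
Proof. by []. Qed.

Section Curve.
Context (A : set R) (c : R -> M).
Hypotheses (oA : open A) (smc : smooth_map A c).

(** After the envelope formula, [nabla_koszul] absorbs the derivative of [G (X, X)] together with
    the part [flat c'] of the momentum in the bracket term. Only the component of [alpha] in the
    annihilator stays paired with the bracket. *)
Lemma hamilton_defect_connection t U (alpha : R -> 'rV[R]_n) dp (X Z : M -> 'rV[R]_n) :
  A t -> open U -> U (c t) -> section_of Q X -> X (c t) = vel c t ->
  gmap G Q (c t) (alpha t) = vel c t -> smooth_field U Z ->
  is_derive t 1 (fun r => ccoord (ch (c t)) (c r) (alpha r)) dp ->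
  hamilton_defect G Q (c t) (alpha t) dp (Z (c t)) =
  'D_1 (fun r => pairing (alpha r) (Z (c r))) t
  - pairing (alpha t - flat G (c t) (vel c t)) (bracket X Z (c t))
  - inner G (c t) (vel c t) (nabla (c t) (vel c t) Z).
Proof.
move=> At oU Uct secX Xv gv sZ Hp.
have [_ ->] := is_derive_pairing_curve oA smc At oU Uct sZ Hp.
rewrite /hamilton_defect (cogram_envelope hG hQ _ secX) ?Xv //.
have := nabla_koszul oU Uct (section_smooth U secX) sZ; rewrite Xv => ->.
rewrite pairingBl -innerE bracketE Xv !innerE !pairingBr.
do 5!(move: (pairing _ _) => ?); move: (dfun _ _ _) => ?.
by ring.
Qed.

(** Metric compatibility along the curve, summed over an expansion of the velocity. The auxiliary
    [g] stands for [alpha (Z)], which is derivable near [t] but agrees with [G (c', Z)] only on the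
    segment. *)
Lemma along_deriv_metric a b t W U (Z : M -> 'rV[R]_n) (g : R -> R) :
  a < b -> a <= t <= b -> A t -> open U -> U (c t) -> smooth_field U Z ->
  along_deriv (@smooth_field R n M) nabla a b c (vel c) t W ->
  derivable g t 1 ->
  (\forall r \near t, a <= r <= b -> g r = inner G (c r) (vel c r) (Z (c r))) ->
  'D_1 g t = inner G (c t) W (Z (c t))
             + inner G (c t) (vel c t) (nabla (c t) (vel c t) Z).
Proof.
move=> ab tab At oU Uct sZ [m [I [U1 [f [e [[oI It oU1 U1ct] [sf se sE ->]]]]]]] dg ge.
pose V := U `&` U1.
have oV : open V by exact: openI.
have Vct : V (c t) by [].
have seV l : smooth_field V (e l) by apply: smooth_field_sub (se l) => y [].
have sZV : smooth_field V Z by apply: smooth_field_sub sZ => y [].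
have Hf l : is_derive t 1 (f l) (derive1 (f l) t).
  by split; [exact: smooth_on_derivable (sf l) It|rewrite derive1E].
have Hi l := is_derive_fun oA smc At oV Vct (Defs.metric_smooth hG oV (seV l) sZV).
pose h r := \sum_l f l r * inner G (c r) (e l (c r)) (Z (c r)).
have Hh := is_derive_suml (fun l => is_derive_mulr (Hf l) (Hi l)).
have [dh Dh] := Hh.
rewrite (@derive_eq_on_segment _ a b t g h ab tab) // ; last first.
  near=> r => rab.
  have -> : g r = inner G (c r) (vel c r) (Z (c r)) by move: rab; near: r.
  rewrite (sE r _ rab); last by near: r; exact: open_nbhs_nbhs.
  rewrite innerE /flat mulmx_suml pairing_suml; apply: eq_bigr => l _.
  by rewrite -scalemxAl pairingZl.
have vE := sE t It tab.
rewrite /h Dh innerE (innerE _ _ (vel c t)) {2}/flat {1}/flat.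
rewrite [X in _ = _ + pairing (X *m _) _]vE !mulmx_suml !pairing_suml -big_split /=.
apply: eq_bigr => l _; rewrite mulmxDl -!scalemxAl pairingDl !pairingZl.
rewrite (nabla_metric hnabla oV (seV l) sZV Vct) !innerE /flat.
by rewrite mulrDr addrA.
Unshelve. all: by end_near. Qed.

End Curve.
End Connection.

(** * Splitting Hamilton's equations along the distribution and its complement *)

Section Splitting.
Context {R : realType} {n k : nat} {M : manifold R n} (G Q : M -> 'M[R]_n).
Hypotheses (hG : riemannian G) (hQ : regular_distribution k Q).
Context (nabla : M -> 'rV[R]_n -> (M -> 'rV[R]_n) -> 'rV[R]_n).
Hypothesis hnabla : levi_civita G nabla.
Implicit Types (U : set M) (x y : M) (p v w z : 'rV[R]_n).

Local Notation ch x := (chart_at x).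
Local Notation at_ x := (phi (chart_at x) x).

Lemma annih_pairing y p v : (p <= annih Q y)%MS -> (v <= Q y)%MS -> pairing p v = 0.
Proof.
move=> /sub_kermxP pQ /submxP[a ->].
by rewrite /pairing trmx_mul mulmxA pQ mul0mx mxE.
Qed.

Lemma pi_Q_id y v : (v <= Q y)%MS -> v *m pi_Q G Q y = v.
Proof. by move=> vQ; rewrite /pi_Q proj_id //; exact: metric_posmx. Qed.

Lemma pi_Q_perp y v : (v <= Qperp G Q y)%MS -> v *m pi_Q G Q y = 0.
Proof. by move=> vQ; rewrite /pi_Q proj_orth //; exact: metric_posmx. Qed.

Lemma pi_Q_sub y v : (v *m pi_Q G Q y <= Q y)%MS.
Proof. exact: proj_sub. Qed.

Lemma pi_perp_sub y v : (v *m pi_perp G Q y <= Qperp G Q y)%MS.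
Proof. exact: projp_sub. Qed.

Lemma orth_split y v : v = v *m pi_Q G Q y + v *m pi_perp G Q y.
Proof. by rewrite (pi_perpE _ hG) mulmxBr mulmx1 addrC subrK. Qed.

Lemma pi_perp_id y v : (v <= Qperp G Q y)%MS -> v *m pi_perp G Q y = v.
Proof. by move=> vQ; rewrite (pi_perpE _ hG) mulmxBr mulmx1 pi_Q_perp // subr0. Qed.

Lemma inner_orth y v w : (v <= Qperp G Q y)%MS -> (w <= Q y)%MS -> inner G y v w = 0.
Proof. by move=> vQ wQ; rewrite /inner (orth_sub vQ wQ) mxE. Qed.

Lemma flat_gmap y p : flat G y (gmap G Q y p) = p *m (pi_Q G Q y)^T.
Proof.
have := cometric_sym (Q y) (metric_tr hG y) (@metric_posmx _ _ _ _ hG y).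
have uG : G y \in unitmx by apply: metric_unit; exact: (metric_posmx hG).
rewrite -[proj_mx _ _]/(pi_Q G Q y) /flat /gmap /sharp.
move: (pi_Q G Q y) => P; rewrite trmx_mul trmx_inv (metric_tr hG) => E.
by rewrite -(mulmxA p) -E -!mulmxA mulVmx // mulmx1.
Qed.

Lemma tau_perp_gmap y p : p *m tau_perp G Q y = p - flat G y (gmap G Q y p).
Proof. by rewrite flat_gmap (tau_perpE _ hG) mulmxBr mulmx1. Qed.

Lemma tau_perp_annih y p : (p *m tau_perp G Q y <= annih Q y)%MS.
Proof. exact: proj_mx_sub. Qed.

Lemma tau_perp_pairing y p v : (v <= Qperp G Q y)%MS ->
  pairing (p *m tau_perp G Q y) v = pairing p v.
Proof.
move=> vQ; rewrite pairing_mulmx (tau_perpE _ hG) linearB /= trmx1 trmxK.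
by rewrite mulmxBr mulmx1 pi_Q_perp // subr0.
Qed.

(** Since [e (X) = 0], the term of [dform] that differentiates [e] along [z] becomes one that
    differentiates [X]. *)
Lemma dformE U x v z (e X : M -> 'rV[R]_n) : open U -> U x ->
  smooth_annih_form Q U e -> section_of Q X -> X x = v ->
  dform e x v z = pairing ('D_v (form_in (ch x) e) (at_ x)) z
     + pairing (e x) ('D_z (field_in (ch x) X) (at_ x)).
Proof.
move=> oU Ux [se ea] secX Xv; rewrite /dform.
have eX y : U y -> pairing (e y) (X y) = 0.
  by move=> Uy; apply: annih_pairing (ea _ Uy) (secX.2 y).
have := annihilating_form_derive z oU Ux se (section_smooth U secX) eX.
rewrite Xv addrC => /eqP; rewrite addr_eq0 => /eqP E.
by congr (_ + _); exact: esym.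
Qed.

Lemma pairing_deltaB U x v z (e : M -> 'rV[R]_n) : open U -> U x -> smooth_form U e ->
  pairing (deltaB x v e) z = dform e x v z.
Proof.
move=> oU Ux se; have de := form_differentiable oU Ux se.
have -> : pairing (deltaB x v e) z = \sum_l z 0 l * dform e x v (delta_mx 0 l).
  rewrite [in LHS](row_sum_delta z) pairing_sumr; apply: eq_bigr => l _.
  by rewrite pairingZr pairing_delta mxE.
have DZ (r : R) w : 'D_(r *: w) (form_in (ch x) e) (at_ x) =
    r *: 'D_w (form_in (ch x) e) (at_ x) by rewrite !deriveE // linearZ.
have Dsum : 'D_z (form_in (ch x) e) (at_ x) =
    \sum_l z 0 l *: 'D_(delta_mx 0 l) (form_in (ch x) e) (at_ x).
  rewrite [in LHS](row_sum_delta z) deriveE // linear_sum; apply: eq_bigr => l _.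
  by rewrite -DZ deriveE.
have dE w : dform e x v w = pairing ('D_v (form_in (ch x) e) (at_ x)) w
  - pairing ('D_w (form_in (ch x) e) (at_ x)) v by [].
move: dE Dsum; move: ('D_v _ _) (fun w => 'D_w (form_in (ch x) e) (at_ x)) => /= Dv D dE Dsum.
rewrite dE Dsum pairing_suml [in pairing Dv z](row_sum_delta z) pairing_sumr -sumrB.
by apply: eq_bigr => l _; rewrite dE pairingZr pairingZl mulrBr.
Qed.

(** Vectors of [Q^perp] do not see the projection [tau_perp], which removes only covectors
    annihilating [Q^perp]. *)
Lemma nablaB_pairing U x v z (e X : M -> 'rV[R]_n) : open U -> U x ->
  smooth_annih_form Q U e -> section_of Q X -> X x = v -> (z <= Qperp G Q x)%MS ->
  pairing (nablaB G Q x v e) z = pairing ('D_v (form_in (ch x) e) (at_ x)) z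
     + pairing (e x) ('D_z (field_in (ch x) X) (at_ x)).
Proof.
move=> oU Ux se secX Xv zQ; rewrite tau_perp_pairing // (pairing_deltaB _ _ oU Ux se.1).
exact: (dformE _ oU Ux se).
Qed.

Section Curve.
Context (A : set R) (c : R -> M).
Hypotheses (oA : open A) (smc : smooth_map A c).

(** The product rule differentiates [Z] along [X], while [nablaB_pairing] differentiates [X] along
    [Z]; the difference of these two terms is the bracket. *)
Lemma along_deriv_annih a b t eta N U (X Z : M -> 'rV[R]_n) (g : R -> R) :
  a < b -> a <= t <= b -> A t -> open U -> U (c t) -> smooth_field U Z ->
  (Z (c t) <= Qperp G Q (c t))%MS ->
  section_of Q X -> X (c t) = vel c t ->
  along_deriv (smooth_annih_form Q) (nablaB G Q) a b c eta t N ->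
  derivable g t 1 ->
  (\forall r \near t, a <= r <= b -> g r = pairing (eta r) (Z (c r))) ->
  'D_1 g t = pairing N (Z (c t)) + pairing (eta t) (bracket X Z (c t)).
Proof.
move=> ab tab At oU Uct sZ ZQ secX Xv [m [I [U1 [f [e [[oI It oU1 U1ct] [sf se sE ->]]]]]]] dg ge.
pose V := U `&` U1.
have oV : open V by exact: openI.
have Vct : V (c t) by [].
have sZV : smooth_field V Z by apply: smooth_field_sub sZ => y [].
have seV l : smooth_form V (e l).
  by move=> i; apply: smooth_on_sub ((se l).1 i); apply: image_subset => y [[]].
have Hf l : is_derive t 1 (f l) (derive1 (f l) t).
  by split; [exact: smooth_on_derivable (sf l) It|rewrite derive1E].
have Hi l := is_derive_form_curve oA smc At oV Vct (seV l) sZV.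
pose h r := \sum_l f l r * pairing (e l (c r)) (Z (c r)).
have Hh := is_derive_suml (fun l => is_derive_mulr (Hf l) (Hi l)).
have [dh Dh] := Hh.
rewrite (@derive_eq_on_segment _ a b t g h ab tab) // ; last first.
  near=> r => rab.
  have -> : g r = pairing (eta r) (Z (c r)) by move: rab; near: r.
  rewrite (sE r _ rab); last by near: r; exact: open_nbhs_nbhs.
  by rewrite pairing_suml; apply: eq_bigr => l _; rewrite pairingZl.
rewrite /h Dh (sE t It tab) !pairing_suml -big_split /=.
apply: eq_bigr => l _; rewrite pairingDl !pairingZl.
rewrite (nablaB_pairing oU1 U1ct (se l) secX Xv ZQ) bracketE Xv pairingBr.
do 4!(move: (pairing _ _) => ?).
by ring.
Unshelve. all: by end_near. Qed.

(** On [Q] the momentum agrees with [flat c'], so [alpha (Z)] is differentiated by metric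
    compatibility, and the terms containing [nabla_c' Z] cancel. *)
Lemma hamilton_defect_Q a b t W (alpha : R -> 'rV[R]_n) dp (X Z : M -> 'rV[R]_n) :
  a < b -> a <= t <= b -> A t -> section_of Q X -> X (c t) = vel c t ->
  (forall r, a <= r <= b -> gmap G Q (c r) (alpha r) = vel c r) ->
  section_of Q Z ->
  is_derive t 1 (fun r => ccoord (ch (c t)) (c r) (alpha r)) dp ->
  along_deriv (@smooth_field R n M) nabla a b c (vel c) t W ->
  hamilton_defect G Q (c t) (alpha t) dp (Z (c t)) =
  inner G (c t) W (Z (c t))
  - pairing (alpha t *m tau_perp G Q (c t)) (bracket X Z (c t)).
Proof.
move=> ab tab At secX Xv gv secZ Hp HW.
have sZ := section_smooth setT secZ.
(* Sections of [Q] are global: the neighbourhood is the whole manifold, and [I] proves membership in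
   [setT]. *)
have [dg _] := is_derive_pairing_curve oA smc At openT I sZ Hp.
rewrite (hamilton_defect_connection hG hQ hnabla oA smc At openT I secX Xv (gv t tab) sZ Hp).
rewrite (along_deriv_metric hG hnabla oA smc ab tab At openT I sZ HW dg).
  by rewrite tau_perp_gmap (gv t tab); ring.
near=> r => rab; rewrite -(gv r rab) innerE flat_gmap pairing_mulmx trmxK pi_Q_id //.
exact: secZ.2.
Unshelve. all: by end_near. Qed.

(** Regularity supplies sections of [Q] only. Test fields with values in [Q^perp] come from
    projecting coordinate fields, hence live on a chart domain. *)
Definition perp_field i z y : 'rV[R]_n := coord_field i z y *m pi_perp G Q y.

Lemma smooth_perp_field i z : smooth_field (dom i) (perp_field i z).
Proof.
have oi : open (phi i @` dom i) by exact: img_open.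
apply: (@smooth_field_chart _ _ _ i) => //; first exact: dom_open.
have E u : (phi i @` dom i) u ->
    z - z *m gram G i u *m cogram G Q i u = field_in i (perp_field i z) u.
  move=> iu; have du := psi_dom iu.
  rewrite /field_in /perp_field (pi_perpE _ hG) mulmxBr mulmx1.
  rewrite [RHS]tcoordE mulmxBl -!tcoordE (pi_coord _ hG) // tcoord_invK //.
  by rewrite psiK.
apply: (smooth_on_ext oi E); apply/(msmooth_rowP oi).
apply: (msmoothB oi); first exact: msmooth_cst.
apply: (msmoothM oi); last exact: smooth_cogram hG hQ _.
apply: (msmoothM oi); [exact: msmooth_cst|exact: smooth_gram].
Qed.

Lemma perp_field_at x z : (z <= Qperp G Q x)%MS -> perp_field (ch x) z x = z.
Proof.
move=> zQ; rewrite /perp_field; have -> : coord_field (ch x) z x = z.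
  by rewrite /coord_field -[LHS](@tcoord_at _ _ _ x) tcoord_invK //; exact: chart_point.
exact: pi_perp_id.
Qed.

(** On [Q^perp] the momentum agrees with its annihilator part [eta], so [along_deriv_annih] applies
    and its bracket term cancels the one in the defect. *)
Lemma hamilton_defect_Qperp a b t N (alpha eta : R -> 'rV[R]_n) dp (X : M -> 'rV[R]_n) z :
  a < b -> a <= t <= b -> A t -> section_of Q X -> X (c t) = vel c t ->
  (forall r, a <= r <= b -> gmap G Q (c r) (alpha r) = vel c r) ->
  (forall r, a <= r <= b -> eta r = alpha r *m tau_perp G Q (c r)) ->
  (forall r, a <= r <= b -> (vel c r <= Q (c r))%MS) ->
  is_derive t 1 (fun r => ccoord (ch (c t)) (c r) (alpha r)) dp ->
  along_deriv (smooth_annih_form Q) (nablaB G Q) a b c eta t N ->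
  (z <= Qperp G Q (c t))%MS ->
  hamilton_defect G Q (c t) (alpha t) dp z =
  pairing N z + inner G (c t) (nabla (c t) (vel c t) X) z.
Proof.
move=> ab tab At secX Xv gv etaE vQ Hp HN zQ.
pose Z := perp_field (ch (c t)) z.
have Zz : Z (c t) = z by exact: perp_field_at.
pose U := dom (ch (c t)).
have oU : open U by exact: dom_open.
have Uct : U (c t) by exact: chart_point.
have sZ : smooth_field U Z by exact: smooth_perp_field.
have ZQ y : (Z y <= Qperp G Q y)%MS by exact: pi_perp_sub.
have sX := section_smooth U secX.
have [dg _] := is_derive_pairing_curve oA smc At oU Uct sZ Hp.
rewrite -Zz (hamilton_defect_connection hG hQ hnabla oA smc At oU Uct secX Xv (gv t tab) sZ Hp).
rewrite (along_deriv_annih ab tab At oU Uct sZ (ZQ _) secX Xv HN dg); last first.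
  near=> r => rab; rewrite (etaE r rab) tau_perp_gmap (gv r rab) pairingBl -innerE.
  by rewrite innerC // inner_orth ?subr0 //; exact: vQ.
(* [X] and [Z] are orthogonal everywhere, so metric compatibility moves the covariant derivative
   from [Z] to [X] at the price of a sign. *)
have : dfun (fun y => inner G y (X y) (Z y)) (c t) (vel c t) = 0.
  rewrite /dfun (_ : _ \o _ = fun=> 0) ?derive_cst //.
  by apply/funext => u /=; rewrite innerC // inner_orth //; exact: secX.2.
rewrite (nabla_metric hnabla oU sX sZ Uct) Xv => /eqP; rewrite addr_eq0 => /eqP ->.
rewrite (etaE t tab) tau_perp_gmap (gv t tab).
by ring.
Unshelve. all: by end_near. Qed.

End Curve.
End Splitting.

(** * Normal extremals and compatible sections *)

Section Main.
Context {R : realType} {n k : nat} {M : manifold R n} (G Q : M -> 'M[R]_n).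
Hypotheses (hG : riemannian G) (hQ : regular_distribution k Q).
Context (nabla : M -> 'rV[R]_n -> (M -> 'rV[R]_n) -> 'rV[R]_n).
Hypothesis hnabla : levi_civita G nabla.
Implicit Types (U : set M) (x y : M) (p v w z : 'rV[R]_n).

Local Notation ch x := (chart_at x).
Local Notation at_ x := (phi (chart_at x) x).

Lemma annih_gmap y p : (p <= annih Q y)%MS -> gmap G Q y p = 0.
Proof.
move=> pa; have uG : G y \in unitmx by apply: metric_unit; exact: (metric_posmx hG).
have : flat G y (gmap G Q y p) = 0.
  rewrite (flat_gmap _ hG); apply/pairing_eq0 => w.
  by rewrite pairing_mulmx trmxK; apply: annih_pairing pa _; exact: pi_Q_sub.
by move=> /(congr1 (mulmx^~ (invmx (G y)))); rewrite /flat /= mulmxK // mul0mx.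
Qed.

Lemma gmap_flat y v : (v <= Q y)%MS -> gmap G Q y (flat G y v) = v.
Proof.
move=> vQ; rewrite /gmap /sharp /flat mulmxK; first exact: (pi_Q_id hG vQ).
by apply: metric_unit; exact: (metric_posmx hG).
Qed.

Lemma gmapD y p p' : gmap G Q y (p + p') = gmap G Q y p + gmap G Q y p'.
Proof. by rewrite /gmap /sharp !mulmxDl. Qed.

Lemma tau_perp_id y p : (p <= annih Q y)%MS -> p *m tau_perp G Q y = p.
Proof. by move=> pa; rewrite (tau_perp_gmap _ hG) annih_gmap // /flat mul0mx subr0. Qed.

Lemma inner_perp_section y v w : (w <= Qperp G Q y)%MS ->
  inner G y (v *m pi_perp G Q y) w = inner G y v w.
Proof.
move=> wQ; rewrite [in RHS](orth_split Q hG y v) [in RHS]innerE /flat mulmxDl pairingDl.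
rewrite -!innerE [X in _ = X + _](innerC hG) (inner_orth wQ) ?add0r //.
exact: pi_Q_sub.
Qed.

Lemma inner_pi_section y v w : (w <= Q y)%MS ->
  inner G y (v *m pi_Q G Q y) w = inner G y v w.
Proof.
move=> wQ; rewrite [in RHS](orth_split Q hG y v) [in RHS]innerE /flat mulmxDl pairingDl.
by rewrite -!innerE [X in _ = _ + X](inner_orth (pi_perp_sub _ _ _ _) wQ) addr0.
Qed.

Section Curve.
Context (A : set R) (c : R -> M).
Hypotheses (oA : open A) (smc : smooth_map A c).

Lemma msmooth_along i m1 m2 (F : 'rV[R]_n -> 'M[R]_(m1, m2)) :
  msmooth (phi i @` dom i) F ->
  msmooth (A `&` c @^-1` dom i) (fun t => F (phi i (c t))).
Proof.
move=> sF k1 k2.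
have oI : open (A `&` c @^-1` dom i) by apply: open_preimage => //; exact: dom_open.
have oB : open (phi i @` dom i) by exact: img_open.
apply: (smooth_on_compose oI oB _ (smc.2 i) (sF k1 k2)).
by move=> t [_ it]; exists (c t).
Qed.

Lemma smooth_tau_along i (alpha : R -> 'rV[R]_n) :
  smooth_on (A `&` c @^-1` dom i) (fun t => ccoord i (c t) (alpha t)) ->
  smooth_on (A `&` c @^-1` dom i)
    (fun t => ccoord i (c t) (alpha t *m tau_perp G Q (c t))).
Proof.
have oI : open (A `&` c @^-1` dom i) by apply: open_preimage => //; exact: dom_open.
move=> /(msmooth_rowP oI) sa.
have E t : (A `&` c @^-1` dom i) t ->
    ccoord i (c t) (alpha t) - ccoord i (c t) (alpha t) *m cogram G Q i (phi i (c t))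
      *m gram G i (phi i (c t)) =
    ccoord i (c t) (alpha t *m tau_perp G Q (c t)).
  by move=> [_ it]; rewrite (tau_perp_coord _ hG).
apply: (smooth_on_ext oI E); apply/(msmooth_rowP oI); apply: (msmoothB oI) => //.
apply: (msmoothM oI); last by apply: msmooth_along; exact: smooth_gram.
by apply: (msmoothM oI) => //; apply: msmooth_along; exact: smooth_cogram hG hQ _.
Qed.

Lemma smooth_flat_along i (eta : R -> 'rV[R]_n) :
  smooth_on (A `&` c @^-1` dom i) (fun t => ccoord i (c t) (eta t)) ->
  smooth_on (A `&` c @^-1` dom i)
    (fun t => ccoord i (c t) (flat G (c t) (vel c t) + eta t)).
Proof.
have oI : open (A `&` c @^-1` dom i) by apply: open_preimage => //; exact: dom_open.
move=> se.
have E t : (A `&` c @^-1` dom i) t ->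
    'D_1 (phi i \o c) t *m gram G i (phi i (c t)) + ccoord i (c t) (eta t) =
    ccoord i (c t) (flat G (c t) (vel c t) + eta t).
  move=> [At it]; rewrite -(vel_coord oA smc At it) -flat_coord //.
  by rewrite !ccoordE mulmxDl.
apply: (smooth_on_ext oI E); apply: smooth_onD => //.
apply/(msmooth_rowP oI); apply: (msmoothM oI).
  by apply/(msmooth_rowP oI); apply: smooth_on_derive; exact: smc.2.
by apply: msmooth_along; exact: smooth_gram.
Qed.

(** The witness expands the velocity in the coordinate fields of the chart around [c t]. *)
Lemma along_deriv_vel a b t : A t ->
  exists W, along_deriv (@smooth_field R n M) nabla a b c (vel c) t W.
Proof.
move=> At; pose i := ch (c t); pose I := A `&` c @^-1` dom i.
have oI : open I by apply: open_preimage => //; exact: dom_open.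
eexists; exists n, I, (dom i), (fun l r => ('D_1 (phi i \o c) r) 0 l),
  (fun l => coord_field i (delta_mx 0 l)); split; [split|split; last reflexivity].
- exact: oI.
- by split => //; exact: chart_point.
- exact: dom_open.
- exact: chart_point.
- move=> l; have : smooth_on I (fun r => 'D_1 (phi i \o c) r) by apply: smooth_on_derive; exact: smc.2.
  by move=> /(smooth_on_coordP _ oI) /(_ 0 l).
- by move=> l; exact: smooth_coord_field.
- move=> r [Ar ir] _; rewrite -[LHS](tcoordK _ ir) (vel_coord oA smc Ar ir).
  rewrite /coord_field /tcoord_inv [X in X *m _ = _]row_sum_delta mulmx_suml.
  by apply: eq_bigr => l _; rewrite scalemxAl.
Qed.

(** The forms [tau_perp (dx^l)]. They span the annihilator of [Q], in general with linear relations,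
    and applying [tau_perp] to the coordinate expansion of a section of [Q^0] expands it in them. *)
Definition coframe i (l : 'I_n) y : 'rV[R]_n :=
  ccoord_inv i y (delta_mx 0 l) *m tau_perp G Q y.

Lemma smooth_coframe i l : smooth_annih_form Q (dom i) (coframe i l).
Proof.
split; last by move=> x _; exact: tau_perp_annih.
have oi : open (phi i @` dom i) by exact: img_open.
apply: (@smooth_form_chart _ _ _ i) => //; first exact: dom_open.
have E u : (phi i @` dom i) u ->
    delta_mx 0 l - delta_mx 0 l *m cogram G Q i u *m gram G i u = form_in i (coframe i l) u.
  move=> iu; have du := psi_dom iu.
  by rewrite /form_in /coframe (tau_perp_coord _ hG) // ccoord_invK // psiK.
apply: (smooth_on_ext oi E); apply/(msmooth_rowP oi).
apply: (msmoothB oi); first exact: msmooth_cst.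
apply: (msmoothM oi); last exact: smooth_gram.
by apply: (msmoothM oi); [exact: msmooth_cst|exact: smooth_cogram hG hQ _].
Qed.

Lemma along_deriv_annih_form a b t (eta : R -> 'rV[R]_n) : A t ->
  (forall i, smooth_on (A `&` c @^-1` dom i) (fun r => ccoord i (c r) (eta r))) ->
  (forall r, a <= r <= b -> (eta r <= annih Q (c r))%MS) ->
  exists N, along_deriv (smooth_annih_form Q) (nablaB G Q) a b c eta t N.
Proof.
move=> At se ea; pose i := ch (c t); pose I := A `&` c @^-1` dom i.
have oI : open I by apply: open_preimage => //; exact: dom_open.
eexists; exists n, I, (dom i), (fun l r => (ccoord i (c r) (eta r)) 0 l),
  (coframe i); split; [split|split; last reflexivity].
- exact: oI.
- by split => //; exact: chart_point.
- exact: dom_open.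
- exact: chart_point.
- by move=> l; have /(smooth_on_coordP _ oI) /(_ 0 l) := se i.
- by move=> l; exact: smooth_coframe.
- move=> r [Ar ir] rab; rewrite -[LHS](tau_perp_id (ea r rab)) -[X in X *m _ = _](ccoordK _ ir).
  rewrite ccoord_invE [X in X *m _ *m _ = _]row_sum_delta !mulmx_suml.
  by apply: eq_bigr => l _; rewrite -!scalemxAl /coframe ccoord_invE.
Qed.

End Curve.

Lemma along_deriv_annih_sub a b c t eta N :
  along_deriv (smooth_annih_form Q) (nablaB G Q) a b c eta t N ->
  (N <= annih Q (c t))%MS.
Proof.
move=> [m [I [U [f [e [[_ _ _ Uct] [_ se _ ->]]]]]]].
apply: summx_sub => l _; apply: addmx_sub; apply: scalemx_sub.
  exact: (se l).2.
exact: tau_perp_annih.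
Qed.

Lemma pairing_bracket_span y v p :
  (forall w, bracket_span Q y v w -> pairing p w = 0) <->
  (forall Y X Y', section_of Q Y -> section_of Q X -> section_of Q Y' -> X y = v ->
     pairing p (Y y + bracket X Y' y) = 0).
Proof.
split=> [H Y X Y' sY sX sY' Xv|H w [m [r [u [Hu ->]]]]].
  apply: H; exists 1%N, (fun=> 1), (fun=> Y y + bracket X Y' y); split.
    by move=> _; exists Y, X, Y'.
  by rewrite big_ord1 scale1r.
rewrite pairing_sumr big1 // => l _; rewrite pairingZr.
by have [Y [X [Y' [sY sX sY' Xv ->]]]] := Hu l; rewrite H ?mulr0.
Qed.

(** * Passing between normal lifts and compatible sections *)

Section Lifts.
Context (a b : R) (c : R -> M).
Hypothesis ab : a < b.

Lemma normal_liftP alpha : normal_lift G Q a b c alpha <->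
  covector_along a b c alpha /\ forall t, a <= t <= b ->
    [/\ alpha t != 0, vel c t = gmap G Q (c t) (alpha t) &
     forall w, hamilton_defect G Q (c t) (alpha t)
       (derive1 (fun r => ccoord (ch (c t)) (c r) (alpha r)) t) w = 0].
Proof.
have E t : (phi (ch (c t)) (c t), ccoord (ch (c t)) (c t) (alpha t)) =
   (at_ (c t), alpha t) by rewrite ccoord_at.
split=> -[ca H]; split => // t tab; have := H t tab.
  by move=> [a0]; rewrite /= E => /(hamilton_iff hG hQ) [gv Ew]; split.
by move=> [a0 gv Ew]; split => //=; rewrite E; apply/(hamilton_iff hG hQ); split.
Qed.

Lemma covector_along_point alpha : covector_along a b c alpha ->
  exists A, [/\ open A, smooth_map A c, forall t, a <= t <= b -> A t &
   (forall i, smooth_on (A `&` c @^-1` dom i) (fun t => ccoord i (c t) (alpha t))) /\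
   forall t, a <= t <= b ->
    is_derive t 1 (fun r => ccoord (ch (c t)) (c r) (alpha r))
     (derive1 (fun r => ccoord (ch (c t)) (c r) (alpha r)) t)].
Proof.
move=> [a' [b' [a'a bb' smc sa]]]; exists `]a', b'[%classic.
have At t : a <= t <= b -> `]a', b'[%classic t.
  by move=> /andP[a1 b1]; rewrite /= in_itv /=; apply/andP; split; lra.
split; [exact: itv_open|exact: smc|exact: At|split; first exact: sa].
move=> t tab; split; last by rewrite derive1E.
apply: smooth_on_derivable (sa (ch (c t))) _; split; [exact: At|exact: chart_point].
Qed.

Lemma lift_compatible alpha : nonholonomic G Q nabla a b c ->
  normal_lift G Q a b c alpha ->
  compatible_section G Q nabla a b c (fun t => alpha t *m tau_perp G Q (c t)).
Proof.
move=> [[_ vQ] nh] /normal_liftP [ca H].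
have [A [oA smc At [sa dp]]] := covector_along_point ca.
have gv r : a <= r <= b -> gmap G Q (c r) (alpha r) = vel c r.
  by move=> /H [].
have an t : a <= t <= b -> (alpha t *m tau_perp G Q (c t) <= annih Q (c t))%MS.
  by move=> _; exact: tau_perp_annih.
split => //.
- have [a' [b' [a'a bb' smc' sa']]] := ca; exists a', b'; split => // i.
  exact: (smooth_tau_along (itv_open _ _) smc' (sa' i)).
- move=> t tab; have [X sX Xv] := hQ.2 (c t) (vel c t) (vQ t tab).
  exists (nabla (c t) (vel c t) X *m pi_perp G Q (c t)); first by exists X.
  have [N HN] := along_deriv_annih_form oA smc (At t tab)
    (fun i => smooth_tau_along oA smc (sa i)) an.
  (* On [Q] both covectors vanish; on [Q^perp] their difference is the Hamilton defect, which is
     zero for a lift. *)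
  suff -> : - flat G (c t) (nabla (c t) (vel c t) X *m pi_perp G Q (c t)) = N by [].
  apply/esym/eqP; rewrite -addr_eq0; apply/eqP/pairing_eq0 => w.
  rewrite (orth_split Q hG (c t) w) pairingDr !pairingDl -!innerE.
  have Na := along_deriv_annih_sub HN.
  rewrite (annih_pairing Na) ?add0r; last exact: pi_Q_sub.
  rewrite (inner_orth (pi_perp_sub G Q _ _) (pi_Q_sub G Q _ _)) add0r.
  have wQ := pi_perp_sub G Q (c t) w.
  rewrite (inner_perp_section _ wQ).
  rewrite -(hamilton_defect_Qperp hG hQ hnabla oA smc ab tab (At t tab) sX Xv gv _ vQ (dp t tab) HN wQ) //.
  by have [_ _ ->] := H t tab.
- move=> t tab; apply/pairing_bracket_span => Y X Y' sY sX sY' Xv.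
  have [W HW W0] := nh t tab.
  have := hamilton_defect_Q hG hQ hnabla oA smc ab tab (At t tab) sX Xv gv sY' (dp t tab) HW.
  have [_ _ ->] := H t tab.
  (* The nonholonomic equation removes the metric term of the defect, so the bracket term vanishes
     by itself. *)
  rewrite -(inner_pi_section _ (sY'.2 _)) W0 innerE /flat mul0mx pairing0l sub0r => /eqP.
  rewrite eq_sym oppr_eq0 => /eqP br0.
  by rewrite pairingDr br0 addr0; apply: annih_pairing (an t tab) (sY.2 _).
Qed.

(** The section is tied to the lift [psi] because the part of Hamilton's equations along [Q] equates
    [nabla_c' c'] with the bracket term of the annihilator component of that very lift. *)
Lemma compatible_nonholonomic psi : tangent_curve Q a b c ->
  normal_lift G Q a b c psi ->
  compatible_section G Q nabla a b c (fun t => psi t *m tau_perp G Q (c t)) ->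
  nonholonomic G Q nabla a b c.
Proof.
move=> tc /normal_liftP [ca H] [_ an _ br]; split => // t tab.
have [_ vQ] := tc.
have [A [oA smc At [sa dp]]] := covector_along_point ca.
have gv r : a <= r <= b -> gmap G Q (c r) (psi r) = vel c r.
  by move=> /H [].
have [W HW] := along_deriv_vel oA smc a b (At t tab).
exists W => //.
have [X sX Xv] := hQ.2 (c t) (vel c t) (vQ t tab).
(* Testing on a section through [pi (nabla_c' c')] itself gives its squared length, which must then
   vanish. *)
have [Z sZ Zz] := hQ.2 (c t) (W *m pi_Q G Q (c t)) (pi_Q_sub _ _ _ _).
have := hamilton_defect_Q hG hQ hnabla oA smc ab tab (At t tab) sX Xv gv sZ (dp t tab) HW.
have [_ _ ->] := H t tab.
have := (pairing_bracket_span _ _ _).1 (br t tab) Z X Z sZ sX sZ Xv.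
rewrite pairingDr (annih_pairing (an t tab) (sZ.2 _)) add0r => ->.
rewrite subr0 -(inner_pi_section _ (sZ.2 _)) Zz => W0.
apply: contrapT => /eqP Wn0; have := Defs.metric_pos hG (c t) Wn0.
by rewrite -W0 ltxx.
Qed.

Lemma compatible_lift eta : (forall t, a <= t <= b -> vel c t != 0) ->
  nonholonomic G Q nabla a b c -> compatible_section G Q nabla a b c eta ->
  normal_lift G Q a b c (fun t => flat G (c t) (vel c t) + eta t).
Proof.
move=> v0 [[_ vQ] nh] [ce an sf br].
set alpha := fun t => _.
have ca : covector_along a b c alpha.
  have [a' [b' [a'a bb' smc' se']]] := ce; exists a', b'; split => // i.
  exact: (smooth_flat_along (itv_open _ _) smc' (se' i)).
have gv r : a <= r <= b -> gmap G Q (c r) (alpha r) = vel c r.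
  by move=> rab; rewrite gmapD gmap_flat ?vQ // annih_gmap ?an // addr0.
have etaE r : a <= r <= b -> eta r = alpha r *m tau_perp G Q (c r).
  by move=> rab; rewrite (tau_perp_gmap _ hG) gv // /alpha addrC addKr.
have [A [oA smc At [sa dp]]] := covector_along_point ca.
apply/normal_liftP; split => // t tab; split; last 2 first.
- by rewrite gv.
- move=> w; rewrite (orth_split Q hG (c t) w) (hamilton_defectD hG hQ).
  (* The section [X] that computes the second fundamental form also extends the velocity in both
     halves of the defect. *)
  have [z [X [sX Xv zE]] HN] := sf t tab.
  rewrite (hamilton_defect_Qperp hG hQ hnabla oA smc ab tab (At t tab) sX Xv gv etaE vQ (dp t tab) HN
    (pi_perp_sub G Q (c t) w)).
  have [Z sZ Zz] := hQ.2 (c t) (w *m pi_Q G Q (c t)) (pi_Q_sub _ _ _ _).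
  have [W HW W0] := nh t tab.
  rewrite -Zz (hamilton_defect_Q hG hQ hnabla oA smc ab tab (At t tab) sX Xv gv sZ (dp t tab) HW).
  rewrite -(inner_pi_section _ (sZ.2 _)) W0 innerE {1}/flat mul0mx pairing0l sub0r -etaE //.
  have := (pairing_bracket_span _ _ _).1 (br t tab) Z X Z sZ sX sZ Xv.
  rewrite pairingDr (annih_pairing (an t tab) (sZ.2 _)) add0r => ->.
  by rewrite oppr0 add0r pairingNl -innerE zE (inner_perp_section _ (pi_perp_sub G Q (c t) w)) addNr.
(* A zero covector would be mapped by [g] to a zero velocity. *)
- apply: contra (v0 t tab) => /eqP a0.
  by rewrite -(gv t tab) a0 /gmap /sharp !mul0mx.
Qed.

End Lifts.
End Main.

Unset Implicit Arguments.

Theorem proposition37 (R : realType) (n k : nat) (M : manifold R n)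
    (G : M -> 'M[R]_n) (hG : riemannian G)
    (nabla : M -> 'rV[R]_n -> (M -> 'rV[R]_n) -> 'rV[R]_n)
    (hnabla : levi_civita G nabla)
    (Q : M -> 'M[R]_n) (hQ : regular_distribution k Q)
    (hQni : ~ integrable_distribution k Q)
    (a b : R) (hab : a < b) (c : R -> M)
    (hc : forall t : R, a <= t <= b -> vel c t != 0) :
  (nonholonomic G Q nabla a b c ->
     (vakonomic G Q a b c <->
      exists eta : R -> 'rV[R]_n, compatible_section G Q nabla a b c eta))
  /\
  (vakonomic G Q a b c ->
     (nonholonomic G Q nabla a b c <->
      exists psi : R -> 'rV[R]_n,
        normal_lift G Q a b c psi /\
        compatible_section G Q nabla a b c
          (fun t => psi t *m tau_perp G Q (c t)))).
Proof.
split=> [nh|[tc [alpha la]]].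
  split=> [[_ [alpha la]]|[eta ce]].
    by eexists; exact: (lift_compatible hG hQ hnabla hab nh la).
  split; first by case: nh.
  by eexists; exact: (compatible_lift hG hQ hnabla hab hc nh ce).
split=> [nh|[psi [lp cp]]].
  by exists alpha; split; [exact: la|exact: (lift_compatible hG hQ hnabla hab nh la)].
exact: (compatible_nonholonomic hG hQ hnabla hab tc lp cp).
Qed.
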